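(* Let $n\ge 2$ and let $f\in\mathbf{k}[x_1,\dots,x_n]$ have degree $n-1$. Expand $\rho_n(f)=f(u_1,u_2-u_1,\dots,u_{n-1}-u_{n-2},-u_{n-1})\in\mathcal{K}_n$ in the basis $\{u_I:I\subseteq\{1,\dots,n-1\}\}$ of $\mathcal{K}_n$ and let $\mathrm{Top}_n(f)$ be the coefficient of $u_1u_2\cdots u_{n-1}$. Then $$\langle f\rangle_n^q=[n-1]_q!\cdot\mathrm{Top}_n(f).$$
   Context: Let $\mathbf{k}$ be a field of characteristic zero and $q\in\mathbf{k}$ not a nontrivial root of unity; $[m]_q!=\prod_{i=1}^m(1+q+\dots+q^{i-1})$. The Klyachko algebra $\mathcal{K}$ is the commutative $\mathbf{k}$-algebra generated by $u_i$, $i\in\mathbb{Z}$, with relations $(q+1)u_i^2=qu_iu_{i-1}+u_iu_{i+1}$; $\mathcal{K}_n$ is its quotient by the ideal generated by all $u_i$ with $i\notin\{1,\dots,n-1\}$. The squarefree monomials $u_I=\prod_{i\in I}u_i$, $I\subseteq\{1,\dots,n-1\}$, form a basis of $\mathcal{K}_n$. $\rho_n:\mathbf{k}[x_1,\dots,x_n]\to\mathcal{K}_n$ is the algebra morphism $x_1\mapsto u_1$, $x_i\mapsto u_i-u_{i-1}$ ($1<i<n$), $x_n\mapsto -u_{n-1}$. For $1\le j\le n-1$, $s_j$ swaps $x_j,x_{j+1}$, $\partial_j g=(g-s_jg)/(x_j-x_{j+1})$, $T_j(g)=(q-1)\partial_j(x_jg)+s_jg$; $T_w=T_{j_1}\cdots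 T_{j_\ell}$ for a reduced word of $w\in S_n$. The $q$-divided symmetrization is $\langle f\rangle_n^q=\sum_{w\in S_n}T_w\big(f/\prod_{j=1}^{n-1}(qx_j-x_{j+1})\big)$. *)

(* Defs.v *)
From HB Require Import structures.
From mathcomp Require Import all_boot all_order all_algebra all_fingroup.
From mathcomp Require Import mpoly.
Set Implicit Arguments. Unset Strict Implicit. Unset Printing Implicit Defensive.
Import Order.TTheory GRing.Theory.
Local Open Scope ring_scope.

Notation "x %:F" := (@FracField.tofrac _ x) .

Section Defs.
Variables (k : fieldType) (q : k) (n : nat).

(* x_{i+1} is 'X_i with i : 'I_n (0-indexed). *)
Definition Pol := {mpoly k[n]}.
Definition RatF := {fraction {mpoly k[n]}}.

(* the index i+1 (as an ordinal); only used when i.+1 < n *)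
Definition ord_succ (i : 'I_n) : 'I_n := insubd i i.+1.

Definition stp (i : 'I_n) : 'S_n := tperm i (ord_succ i).

Definition spol (i : 'I_n) (p : Pol) : Pol := msym (stp i) p.

Definition sfrac (i : 'I_n) (g : RatF) : RatF :=
  let r := frac (@repr_of _ RatF g) in
  (spol i r.1)%:F / (spol i r.2)%:F.

Definition xF (i : 'I_n) : RatF := ('X_i : Pol)%:F.
Definition cF (c : k) : RatF := (c%:MP : Pol)%:F.

Definition ddiff (i : 'I_n) (g : RatF) : RatF :=
  (g - sfrac i g) / (xF i - xF (ord_succ i)).

Definition Top_T (i : 'I_n) (g : RatF) : RatF :=
  cF (q - 1) * ddiff i (xF i * g) + sfrac i g.

Definition Tword (s : seq 'I_n) (g : RatF) : RatF := foldr Top_T g s.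

Definition inversions (w : 'S_n) : nat :=
  #|[set p : 'I_n * 'I_n | (p.1 < p.2)%N && (w p.2 < w p.1)%N]|.

Definition reduced_word (w : 'S_n) (s : seq 'I_n) : bool :=
  [&& all (fun i : 'I_n => i.+1 < n)%N s,
      (\prod_(i <- s) stp i)%g == w & size s == inversions w].

Definition qdivsym (rw : 'S_n -> seq 'I_n) (f : Pol) : RatF :=
  \sum_(w : 'S_n) Tword (rw w)
     (f%:F / \prod_(i : 'I_n | (i.+1 < n)%N)
                ((q *: 'X_i - 'X_(ord_succ i) : Pol)%:F)).

Definition qfact (m : nat) : k := \prod_(i < m) \sum_(l < i.+1) q ^+ l.

(* K_n = k[u_1..u_{n-1}] / (relations); u_i is 'X_(i-1) in {mpoly k[n.-1]},
   and u_i := 0 for i outside {1..n-1}. *)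
Definition KPol := {mpoly k[n.-1]}.

Definition uu (i : nat) : KPol := \sum_(j : 'I_n.-1 | j.+1 == i) 'X_j.

Definition krel (i : nat) : KPol :=
  (q + 1) *: (uu i ^+ 2) - q *: (uu i * uu i.-1) - uu i * uu i.+1.

(* membership in the defining ideal of K_n (relations for i in 1..n-1;
   those for other i are 0 since the u_i vanish there) *)
Definition in_Kideal (p : KPol) : Prop :=
  exists c : nat -> KPol, p = \sum_(1 <= i < n) c i * krel i.

Definition rho_x (j : 'I_n) : KPol :=
  if j == 0%N :> nat then uu 1
  else if j.+1 == n then - uu n.-1
  else uu j.+1 - uu j.

Definition rho (f : Pol) : KPol := f \mPo [tuple rho_x j | j < n].

Definition uI (I : {set 'I_n.-1}) : KPol := \prod_(j in I) 'X_j.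

End Defs.

(* Main.v *)
(* Write y_j = x_1 + ... + x_j and l_j = q x_j - x_{j+1}. The operators T_j satisfy
   the braid relations, so T_w depends on w only, and both S = sum_w T_w and
   S' g = sum_w w(g prod_{a<b} (q x_a - x_b) / (x_a - x_b)) satisfy
   S'(1) S = (sum_w q^{l(w)}) S', because S g is symmetric and S' T_j = q S'.
   As S'(1) = sum_w q^{l(w)} = [n]_q!, S = S'. Hence the q-divided symmetrization
   of f is the antisymmetrization of f prod_{b >= a+2} (q x_a - x_b) divided by
   the Vandermonde product, and its constant term [residue f] is a coefficient.
   This functional kills the ideal generated by y_n and the y_j l_j; since
   y_j l_j is the image of the j-th Klyachko relation under u_j |-> y_j, the
   functional factors through K_n. It remains to evaluate it at y_1 ... y_{n-1}:
   modulo the relations, l_1 ... l_{n-1} = [n]_q y_1 ... y_{n-1}, while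
   residue (l_1 ... l_{n-1}) = S'(1) = [n]_q!. *)
Require Import Defs.
From HB Require Import structures.
From mathcomp Require Import all_boot all_order all_algebra all_fingroup.
From mathcomp Require Import mpoly.
From mathcomp Require Import zify ring.
Import Order.TTheory GRing.Theory.
Local Open Scope ring_scope.
Set Implicit Arguments. Unset Strict Implicit. Unset Printing Implicit Defensive.

(** * Reduced words and Matsumoto's theorem *)

Section Words.
Variable n : nat.
Implicit Types (i j : 'I_n) (w : 'S_n) (s t : seq 'I_n).

Lemma val_ord_succ i : (i.+1 < n)%N -> ord_succ i = i.+1 :> nat.
Proof. by move=> hi; rewrite /ord_succ val_insubd hi. Qed.

Lemma neq_ord_succ i : (i.+1 < n)%N -> i != ord_succ i.
Proof. by move=> hi; rewrite -val_eqE /= val_ord_succ //; lia. Qed.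

Lemma stpK i w : (stp i * (stp i * w))%g = w.
Proof. by rewrite mulgA /stp tperm2 mul1g. Qed.

Lemma stpL i : stp i i = ord_succ i.
Proof. exact: tpermL. Qed.

Lemma stpR i : stp i (ord_succ i) = i.
Proof. exact: tpermR. Qed.

Lemma stp_far i j : (i.+1 < j)%N -> (j.+1 < n)%N ->
  [/\ stp i j = j, stp i (ord_succ j) = ord_succ j, stp j i = i
    & stp j (ord_succ i) = ord_succ i].
Proof.
move=> ij hj; have hi : (i.+1 < n)%N by lia.
have ei := val_ord_succ hi; have ej := val_ord_succ hj.
by split; rewrite /stp tpermD // -val_eqE /= ?ei ?ej; lia.
Qed.

Lemma stp_commute i j : (i.+1 < j)%N -> (j.+1 < n)%N ->
  (stp i * stp j = stp j * stp i)%g.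
Proof.
move=> ij hj; have [_ _ ji1 ji2] := stp_far ij hj.
by apply/commgP/conjg_fixP; rewrite /stp tpermJ -/(stp j) ji1 ji2.
Qed.

Lemma stp_near i j : j = i.+1 :> nat -> (j.+1 < n)%N ->
  [/\ ord_succ i = j, stp i j = i, stp i (ord_succ j) = ord_succ j & stp j i = i].
Proof.
move=> ij hj; have hi : (i.+1 < n)%N by lia.
have ei := val_ord_succ hi; have ej := val_ord_succ hj.
have Sij : ord_succ i = j by apply: val_inj; rewrite /= ei.
rewrite /stp Sij tpermR; split=> //; rewrite tpermD // -val_eqE /= ?ej; lia.
Qed.

Lemma stp_braid i j : j = i.+1 :> nat -> (j.+1 < n)%N ->
  (stp i * (stp j * stp i) = stp j * (stp i * stp j))%g.
Proof.
move=> ij hj; have [Sij sij sik sji] := stp_near ij hj.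
have -> : (stp i * (stp j * stp i) = stp j ^ stp i)%g by rewrite /conjg /stp tpermV.
have -> : (stp j * (stp i * stp j) = stp i ^ stp j)%g by rewrite /conjg /stp tpermV.
by rewrite {1 3}/stp !tpermJ Sij sij sik sji stpL.
Qed.

(** No index lies strictly between [i] and its successor, so the swap reverses the order of that
    pair alone, and the exclusion removes it on both sides. *)
Lemma stp_ltn i a b : (i.+1 < n)%N ->
  (stp i a < stp i b)%N && ((stp i a, stp i b) != (i, ord_succ i)) =
  (a < b)%N && ((a, b) != (i, ord_succ i)).
Proof.
move=> hi; have hs := val_ord_succ hi; have hne := neq_ord_succ hi.
rewrite /stp !xpair_eqE.
have hnat (c : 'I_n) : c != i -> c != ord_succ i -> (c != i :> nat) && (c != i.+1 :> nat).
  by rewrite -!val_eqE /= hs => -> ->.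
case: tpermP => [->|->|/eqP ai /eqP aS]; case: tpermP => [->|->|/eqP bi /eqP bS];
  rewrite ?eqxx ?[ord_succ i == i]eq_sym ?(negPf hne) ?(negPf ai) ?(negPf bS)
    ?andbF ?hs /=; try lia.
- by have := hnat _ bi bS; lia.
- by have := hnat _ bi bS; lia.
- by have := hnat _ ai aS; lia.
- by have := hnat _ ai aS; lia.
Qed.

(** This invariance is behind every later exchange argument: for inversion counts, for [qkernel] and
    for [vdm]. *)
Lemma big_ltn_stp (R : Type) (idx : R) (op : Monoid.com_law idx) i
    (F : 'I_n -> 'I_n -> R) : (i.+1 < n)%N ->
  \big[op/idx]_(p : 'I_n * 'I_n | (p.1 < p.2)%N && (p != (i, ord_succ i)))
     F (stp i p.1) (stp i p.2) =
  \big[op/idx]_(p : 'I_n * 'I_n | (p.1 < p.2)%N && (p != (i, ord_succ i)))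
     F p.1 p.2.
Proof.
move=> hi.
have hK : involutive (fun p : 'I_n * 'I_n => (stp i p.1, stp i p.2)).
  by move=> [a b] /=; rewrite !tpermK.
rewrite [RHS](reindex_inj (inv_inj hK)) /=.
by apply: eq_bigl => -[a b] /=; rewrite stp_ltn.
Qed.

Lemma inversionsE w :
  inversions w = (\sum_(p : 'I_n * 'I_n | (p.1 < p.2)%N) (w p.2 < w p.1))%N.
Proof.
by rewrite /inversions -sum1dep_card big_mkcondr /=; apply: eq_bigr => p _; case: ifP.
Qed.

Lemma big_ltn_succ (R : Type) (idx : R) (op : Monoid.com_law idx) i
    (F : 'I_n * 'I_n -> R) : (i.+1 < n)%N ->
  \big[op/idx]_(p : 'I_n * 'I_n | (p.1 < p.2)%N) F p =
  op (F (i, ord_succ i))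
   (\big[op/idx]_(p : 'I_n * 'I_n | (p.1 < p.2)%N && (p != (i, ord_succ i))) F p).
Proof. by move=> hi; rewrite (bigD1 (i, ord_succ i)) //= val_ord_succ. Qed.

(** Only the pair at [i] changes status. Booleans added on both sides cover ascents and descents at
    once, without truncated subtraction. *)
Lemma inversions_stp i w : (i.+1 < n)%N ->
  (inversions (stp i * w) + (w (ord_succ i) < w i) =
   inversions w + (w i < w (ord_succ i)))%N.
Proof.
move=> hi; rewrite !inversionsE !(big_ltn_succ _ _ hi) /=.
under eq_bigr do rewrite !permM.
rewrite (big_ltn_stp _ (fun a b => nat_of_bool (w b < w a)%N) hi) !permM.
by rewrite tpermL tpermR /= [LHS]addnC [LHS]addnCA [LHS]addnC.
Qed.

Lemma inversions_desc i w : (i.+1 < n)%N -> (w (ord_succ i) < w i)%N ->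
  inversions w = (inversions (stp i * w)).+1.
Proof. by move=> hi hd; have := inversions_stp w hi; rewrite hd; lia. Qed.

Lemma ltn_perm_succ i w : (i.+1 < n)%N ->
  (w i < w (ord_succ i))%N = ~~ (w (ord_succ i) < w i)%N.
Proof.
move=> hi; rewrite -leqNgt ltn_neqAle; case: (_ <= _)%N; rewrite ?andbF ?andbT //.
by rewrite val_eqE (inj_eq perm_inj) neq_ord_succ.
Qed.

Lemma inversions1 : inversions (1 : 'S_n) = 0%N.
Proof. by rewrite inversionsE big1 // => p; rewrite !perm1; lia. Qed.

Lemma inversions_prod s : all (fun i : 'I_n => i.+1 < n)%N s ->
  (inversions (\prod_(i <- s) stp i)%g <= size s)%N.
Proof.
elim: s => [_|i s IH /= /andP[hi /IH h]]; first by rewrite big_nil inversions1.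
rewrite big_cons; set u := (\prod_(i <- s) stp i)%g in h *.
have h1 : (inversions (stp i * u) <= (inversions u).+1)%N.
  by have := inversions_stp u hi; lia.
exact: leq_trans h1 _.
Qed.

Lemma reduced_word_cons w i s : reduced_word w (i :: s) ->
  [/\ (i.+1 < n)%N, (w (ord_succ i) < w i)%N & reduced_word (stp i * w)%g s].
Proof.
case/and3P => /= /andP[hi hs] /eqP; rewrite big_cons => <-.
set u := (\prod_(i <- s) stp i)%g => /eqP hsz.
have hle : (inversions u <= size s)%N by exact: inversions_prod.
have := inversions_stp u hi; rewrite -hsz => hu.
(* [u] has at most [size s] inversions while [stp i * u] has one more than [size s], so prepending
   [i] must raise the length. *)
have hlt : (u i < u (ord_succ i))%N by lia.
split => //; first by rewrite !permM tpermR tpermL.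
by rewrite /reduced_word hs stpK eqxx /=; move: hu; rewrite hlt => hu; apply/eqP; lia.
Qed.

Lemma cons_reduced_word w i s : (i.+1 < n)%N -> (w (ord_succ i) < w i)%N ->
  reduced_word (stp i * w)%g s -> reduced_word w (i :: s).
Proof.
move=> hi hd /and3P[hs /eqP hp /eqP hsz].
by rewrite /reduced_word /= hi hs big_cons hp stpK eqxx hsz -inversions_desc /=.
Qed.

Variables (X : Type) (T : 'I_n -> X -> X).
Variable rw : 'S_n -> seq 'I_n.
Hypothesis rwP : forall w, reduced_word w (rw w).
Hypothesis braid_far : forall i j, (i.+1 < j)%N -> (j.+1 < n)%N ->
  forall g, T i (T j g) = T j (T i g).
Hypothesis braid_near : forall i j, j = i.+1 :> nat -> (j.+1 < n)%N ->
  forall g, T i (T j (T i g)) = T j (T i (T j g)).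

(* Two distinct descents i, j of w generate a dihedral group whose longest
   element is a left factor of w; its two reduced words are linked by a braid
   relation, and the induction handles what precedes and follows. *)
Lemma matsumoto w s t g : reduced_word w s -> reduced_word w t ->
  foldr T g s = foldr T g t.
Proof.
move: {2}(inversions w) (erefl (inversions w)) => l.
elim: l w s t => [|l IH] w s t hl.
  case/and3P => _ _ /eqP; rewrite hl => /size0nil ->.
  by case/and3P => _ _ /eqP; rewrite hl => /size0nil ->.
case: s => [/and3P[_ _]|i s hs]; first by rewrite hl.
case: t => [/and3P[_ _]|j t ht]; first by rewrite hl.
wlog le_ij : i j s t hs ht / (i <= j)%N.
  by move=> H; case: (leqP i j) => [le|/ltnW le]; [|symmetry]; apply: H.
have [hi di rs] := reduced_word_cons hs; have [hj dj rt] := reduced_word_cons ht.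
have hli : inversions (stp i * w) = l.
  by apply: succn_inj; rewrite -inversions_desc.
have hlj : inversions (stp j * w) = l.
  by apply: succn_inj; rewrite -inversions_desc.
case: (ltngtP i j) le_ij => // [lt_ij _|/val_inj eij _]; last first.
  by rewrite -eij in rt *; rewrite /= (IH _ _ _ hli rs rt).
case: (ltngtP i.+1 j) => [far||/esym near]; [|by lia|].
- have [ij1 ij2 ji1 ji2] := stp_far far hj.
  (* [u] is [w] without its left factor [stp i * stp j]; its chosen word serves as the common tail
     of both reduced words. *)
  pose u := (stp j * (stp i * w))%g.
  have hu : u = (stp i * (stp j * w))%g by rewrite /u !mulgA (stp_commute far hj).
  have rA : reduced_word (stp i * w) (j :: rw u).
    by apply: cons_reduced_word (rwP _) => //; rewrite !permM ij1 ij2.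
  have rB : reduced_word (stp j * w) (i :: rw u).
    apply: cons_reduced_word => //; last by rewrite -hu; apply: rwP.
    by rewrite !permM ji1 ji2.
  by rewrite /= (IH _ _ _ hli rs rA) (IH _ _ _ hlj rt rB) /= braid_far.
have [Sij sij sik sji] := stp_near near hj.
(* Adjacent descents make [w] decreasing on three consecutive indices, so the longest element of
   their S_3 splits off on the left. *)
have dij : (w (ord_succ j) < w i)%N by apply: ltn_trans dj _; rewrite -Sij.
pose u := (stp i * (stp j * (stp i * w)))%g.
have hu : u = (stp j * (stp i * (stp j * w)))%g.
  by have := stp_braid near hj; rewrite /u !mulgA => ->.
have rA : reduced_word (stp i * w) [:: j, i & rw u].
  apply: cons_reduced_word; rewrite // ?permM ?sij ?sik //.
  apply: cons_reduced_word (rwP _) => //.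
  by rewrite !permM Sij stpL sik sji stpL Sij.
have rB : reduced_word (stp j * w) [:: i, j & rw u].
  apply: cons_reduced_word; rewrite // ?permM ?Sij ?stpL ?sji //.
  apply: cons_reduced_word => //; last by rewrite -hu; apply: rwP.
  by rewrite !permM sij sik sji stpR -Sij.
by rewrite /= (IH _ _ _ hli rs rA) (IH _ _ _ hlj rt rB) /= braid_near.
Qed.

End Words.

(** * Symmetric group action on fractions and Demazure-Lusztig operators *)

Lemma fracE (R : idomainType) (x : {fraction R}) :
  x = (frac (@repr_of _ {fraction R} x)).1%:F / (frac (@repr_of _ {fraction R} x)).2%:F.
Proof.
set z := @repr_of _ _ x; have hd : z.2%:F != 0 :> {fraction R}.
  by rewrite tofrac_eq0 denom_ratioP.
apply: (mulIf hd); rewrite divfK //; have : \pi_({fraction R})%qT z = x by rewrite unlock; exact: repr_ofK.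
move: z {hd} => z <-; unlock FracField.tofrac; rewrite -[LHS]FracField.pi_mul.
apply/eqmodP; rewrite /= FracField.equivfE /FracField.mulf.
by rewrite !numden_Ratio ?mulf_neq0 ?denom_ratioP ?oner_neq0 // !mulr1 mulrC.
Qed.

Section Action.
Variables (k : fieldType) (n : nat).
Local Notation P := {mpoly k[n]}.
Local Notation F := (RatF k n).
Implicit Types (i j : 'I_n) (w : 'S_n) (p : P) (g h : F).

(** The formula of [sfrac], for an arbitrary permutation; the shared choice of representative makes
    [sfracE] hold by conversion. *)
Definition msymF w g : F :=
  (msym w (frac (@repr_of _ F g)).1)%:F / (msym w (frac (@repr_of _ F g)).2)%:F.

Lemma sfracE i g : sfrac i g = msymF (stp i) g.
Proof. by []. Qed.

Lemma msym_eq0 w p : (msym w p == 0) = (p == 0).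
Proof. by rewrite -(inj_eq (@inj_msym _ _ w) p 0) msym0. Qed.

(** Independence of the representative: equality of fractions is equality of cross products, which
    [msym w] respects. *)
Lemma msymF_div w p r : r != 0 -> msymF w (p%:F / r%:F) = (msym w p)%:F / (msym w r)%:F.
Proof.
move=> r0; have := fracE (p%:F / r%:F : F); rewrite /msymF.
set x := (@repr_of _ F _); have hx : x.2 != 0 by exact: denom_ratioP.
move=> /esym/eqP; rewrite eqr_div ?tofrac_eq0 // -!tofracM tofrac_eq => /eqP e.
apply/eqP; rewrite eqr_div ?tofrac_eq0 ?msym_eq0 // -!tofracM tofrac_eq.
by rewrite -!msymM e.
Qed.

Lemma msymF_tofrac w p : msymF w p%:F = (msym w p)%:F.
Proof. by rewrite -[p%:F]divr1 -tofrac1 msymF_div ?oner_neq0 // msym1 tofrac1 divr1. Qed.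

Lemma fracW (Q : F -> Prop) : (forall p r, r != 0 -> Q (p%:F / r%:F)) -> forall g, Q g.
Proof. by move=> H g; rewrite (fracE g); apply/H/denom_ratioP. Qed.

Lemma msymFD w : {morph msymF w : g h / g + h}.
Proof.
elim/fracW => p r r0; elim/fracW => p' r' r0'.
rewrite addf_div ?tofrac_eq0 // -!tofracM -tofracD !msymF_div ?mulf_neq0 //.
by rewrite addf_div ?tofrac_eq0 ?msym_eq0 // -!tofracM -tofracD !(msymM, msymD).
Qed.

Lemma msymFM w : {morph msymF w : g h / g * h}.
Proof.
elim/fracW => p r r0; elim/fracW => p' r' r0'.
by rewrite mulf_div -!tofracM !msymF_div ?mulf_neq0 // mulf_div -!tofracM !msymM.
Qed.

Lemma msymF0 w : msymF w 0 = 0.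
Proof. by rewrite -tofrac0 msymF_tofrac msym0. Qed.

Lemma msymF1 w : msymF w 1 = 1.
Proof. by rewrite -tofrac1 msymF_tofrac msym1. Qed.

Lemma msymFN w : {morph msymF w : g / - g}.
Proof. by move=> g; apply/eqP; rewrite -addr_eq0 -msymFD addNr msymF0. Qed.

Lemma msymF_sum w I (r : seq I) (Q : pred I) (G : I -> F) :
  msymF w (\sum_(i <- r | Q i) G i) = \sum_(i <- r | Q i) msymF w (G i).
Proof. exact: (big_morph _ (msymFD w) (msymF0 w)). Qed.

Lemma msymF_prod w I (r : seq I) (Q : pred I) (G : I -> F) :
  msymF w (\prod_(i <- r | Q i) G i) = \prod_(i <- r | Q i) msymF w (G i).
Proof. exact: (big_morph _ (msymFM w) (msymF1 w)). Qed.

Lemma msymFV w : {morph msymF w : g / g^-1}.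
Proof.
move=> g; have [->|g0] := eqVneq g 0; first by rewrite invr0 msymF0 invr0.
have h : msymF w g * msymF w g^-1 = 1 by rewrite -msymFM divff ?msymF1.
have a0 : msymF w g != 0 by apply: contra_eq_neq h => ->; rewrite mul0r eq_sym oner_neq0.
by apply: (mulfI a0); rewrite h divff.
Qed.

(** Permutations multiply from left to right, hence [w1] acts first. *)
Lemma msymF_comp w1 w2 g : msymF (w1 * w2)%g g = msymF w2 (msymF w1 g).
Proof.
elim/fracW: g => p r r0; rewrite (msymF_div w1 p r0) (msymF_div _ p r0) !msymMm.
by rewrite msymF_div // msym_eq0.
Qed.

Lemma msymF_id g : msymF 1%g g = g.
Proof. by elim/fracW: g => p r r0; rewrite msymF_div // !msym1m. Qed.

Lemma msymXU w i : msym w 'X_i = 'X_(w i) :> P.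
Proof.
rewrite msymX; congr 'X_[_]; apply/mnmP => j; rewrite mnmE !mnm1E.
by rewrite -(inj_eq (@perm_inj _ w)) permKV.
Qed.

Lemma msymF_xF w i : msymF w (xF k i) = xF k (w i).
Proof. by rewrite /xF msymF_tofrac msymXU. Qed.

Lemma msymC w (c : k) : msym w c%:MP = c%:MP :> P.
Proof. by rewrite -[c%:MP]mulr1 mul_mpolyC msymZ msym1. Qed.

Lemma msymF_cF w (c : k) : msymF w (cF n c) = cF n c.
Proof. by rewrite /cF msymF_tofrac msymC. Qed.

Lemma xF_neq i j : i != j -> xF k i - xF k j != 0.
Proof.
move=> ij; rewrite subr_eq0 /xF tofrac_eq; apply: contra ij => /eqP e.
have := mcoeffXU k i j; rewrite e mcoeffXU eqxx; case: eqP => // _ /eqP.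
by rewrite oner_eq0.
Qed.

End Action.

Local Opaque msymF.

(** * Rational identities behind the operators T_j *)

Section DemazureLusztig.
Variable F : fieldType.
Implicit Types a b c d e g : F.

(** T_j in expanded form, with [a], [b] for x_j, x_{j+1}, [d] for q and [g'] for the image of [g]
    under s_j. Treating these as independent elements lets [field] decide the relations. *)
Definition dl d a b g g' := ((d - 1) * a * g + (a - d * b) * g') / (a - b).

Lemma dl_ddiff d a b g g' : a - b != 0 ->
  (d - 1) * ((a * g - b * g') / (a - b)) + g' = dl d a b g g'.
Proof. by rewrite /dl => h; field. Qed.

Lemma dlD1 d a b g g' : a - b != 0 ->
  g + dl d a b g g' = (d * a - b) / (a - b) * g + (d * b - a) / (b - a) * g'.
Proof. by rewrite /dl => h; field; rewrite h -opprB oppr_eq0 h. Qed.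

Lemma dl_far d a b c e g gi gj gij : a - b != 0 -> c - e != 0 ->
  dl d a b (dl d c e g gj) (dl d c e gi gij) = dl d c e (dl d a b g gi) (dl d a b gj gij).
Proof. by rewrite /dl => h1 h2; field; rewrite h1 h2. Qed.

(** The elements [g] to [gw] stand for the six images of one fraction under the S_3 permuting [a],
    [b], [c]. *)
Lemma dl_near d a b c g gi gj gij gji gw :
  a - b != 0 -> a - c != 0 -> b - c != 0 ->
  dl d a b (dl d b c (dl d a b g gi) (dl d a c gj gij))
           (dl d a c (dl d b a gi g) (dl d b c gji gw)) =
  dl d b c (dl d a b (dl d b c g gj) (dl d a c gi gji))
           (dl d a c (dl d c b gj g) (dl d a b gij gw)).
Proof.
rewrite /dl => h1 h2 h3.
have h4 : b - a != 0 by rewrite -opprB oppr_eq0.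
have h6 : c - b != 0 by rewrite -opprB oppr_eq0.
by field; rewrite h1 h2 h3 h4 h6.
Qed.

End DemazureLusztig.

(** * Factorization of 1 + T_j and the braid relations *)

Section HeckeOperators.
Variables (k : fieldType) (q : k) (n : nat).
Local Notation P := {mpoly k[n]}.
Local Notation F := (RatF k n).
Implicit Types (i j : 'I_n) (w : 'S_n) (p : P) (g h : F).
Local Notation x i := (xF k i).
Local Notation qF := (cF n q).

Lemma Top_TE i g : (i.+1 < n)%N ->
  Top_T q i g = dl qF (x i) (x (ord_succ i)) g (msymF (stp i) g).
Proof.
move=> hi; rewrite -dl_ddiff ?xF_neq ?neq_ord_succ //.
rewrite /Top_T /ddiff !sfracE msymFM msymF_xF [stp i i]tpermL.
by have -> : cF n (q - 1) = qF - 1 by rewrite /cF mpolyCB tofracB mpolyC1 tofrac1.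
Qed.

Lemma msymF_dl w a b g h :
  msymF w (dl qF a b g h) = dl qF (msymF w a) (msymF w b) (msymF w g) (msymF w h).
Proof. by rewrite /dl !(msymFM, msymFV, msymFD, msymFN) msymF_cF msymF1. Qed.

Definition qratio i j : F := (qF * x i - x j) / (x i - x j).

Lemma msymF_qratio w i j : msymF w (qratio i j) = qratio (w i) (w j).
Proof. by rewrite /qratio !(msymFM, msymFV, msymFD, msymFN) msymF_cF !msymF_xF. Qed.

(** Thus 1 + T_i is multiplication by a [qratio] followed by 1 + s_i: its values are s_i-invariant,
    and the symmetrizer [qsym] can absorb it. *)
Lemma Top_T1E i g : (i.+1 < n)%N ->
  g + Top_T q i g =
  qratio i (ord_succ i) * g + msymF (stp i) (qratio i (ord_succ i) * g).
Proof.
move=> hi; rewrite Top_TE // dlD1 ?xF_neq ?neq_ord_succ //.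
by rewrite msymFM msymF_qratio /stp tpermL tpermR.
Qed.

Lemma Top_T_far i j g : (i.+1 < j)%N -> (j.+1 < n)%N ->
  Top_T q i (Top_T q j g) = Top_T q j (Top_T q i g).
Proof.
move=> ij hj; have hi : (i.+1 < n)%N by lia.
have [ij1 ij2 ji1 ji2] := stp_far ij hj.
rewrite !(Top_TE _ hi) !(Top_TE _ hj) !msymF_dl !msymF_xF ij1 ij2 ji1 ji2 -!msymF_comp.
rewrite (stp_commute ij hj).
by apply: dl_far; rewrite xF_neq ?neq_ord_succ.
Qed.

Lemma Top_T_near i j g : j = i.+1 :> nat -> (j.+1 < n)%N ->
  Top_T q i (Top_T q j (Top_T q i g)) = Top_T q j (Top_T q i (Top_T q j g)).
Proof.
move=> ij hj; have hi : (i.+1 < n)%N by lia.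
have [Sij sij sik sji] := stp_near ij hj.
have [nij njk] : i != j /\ j != ord_succ j by rewrite -{1}Sij !neq_ord_succ.
have nik : i != ord_succ j by rewrite -val_eqE /= val_ord_succ //; lia.
have Ei u u' : msymF (stp i) u = u' -> Top_T q i u = dl qF (x i) (x j) u u'.
  by move=> <-; rewrite Top_TE // Sij.
have Ej u u' : msymF (stp j) u = u' -> Top_T q j u = dl qF (x j) (x (ord_succ j)) u u'.
  by move=> <-; rewrite Top_TE.
have msymFK c u : msymF (stp c) (msymF (stp c) u) = u by rewrite -msymF_comp /stp tperm2 msymF_id.
have [gi ei0] : {u | msymF (stp i) g = u} by eexists.
have [gj ej0] : {u | msymF (stp j) g = u} by eexists.
have [gij eij] : {u | msymF (stp j) gi = u} by eexists.
have [gji eji] : {u | msymF (stp i) gj = u} by eexists.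
have [gw ew] : {u | msymF (stp i) gij = u} by eexists.
(* The orbit of [g] closes up here: both words of length three give the longest element of S_3. *)
have ew' : msymF (stp j) gji = gw.
  by rewrite -ew -eij -eji -ei0 -ej0 -!msymF_comp (stp_braid ij hj).
have ei1 : msymF (stp i) gi = g by rewrite -ei0 msymFK.
have ej1 : msymF (stp j) gj = g by rewrite -ej0 msymFK.
rewrite (Ei _ _ ei0) (Ej _ _ ej0).
rewrite (Ej _ (dl qF (x i) (x (ord_succ j)) gj gij)); last first.
  by rewrite msymF_dl !msymF_xF sji stpL ej0 eij.
rewrite (Ei (dl _ _ _ g gj) (dl qF (x i) (x (ord_succ j)) gi gji)); last first.
  by rewrite msymF_dl !msymF_xF sij sik ei0 eji.
rewrite (Ei _ (dl qF (x i) (x (ord_succ j)) (dl qF (x j) (x i) gi g)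
                  (dl qF (x j) (x (ord_succ j)) gji gw))); last first.
  by rewrite !msymF_dl !msymF_xF sij sik stpL Sij ei0 ei1 eji ew.
rewrite (Ej _ (dl qF (x i) (x (ord_succ j)) (dl qF (x (ord_succ j)) (x j) gj g)
                  (dl qF (x i) (x j) gij gw))); last first.
  by rewrite !msymF_dl !msymF_xF sji stpR stpL ej0 ej1 eij ew'.
by apply: dl_near; rewrite xF_neq.
Qed.

End HeckeOperators.

(** * The sum of the operators T_w *)

Lemma add_mul_exchange (R : comPzRingType) (a b d g r : R) : a + b = d + 1 ->
  a * g * (a * r) + a * g * (b * r) = g * (a * r) + d * (g * (a * r)).
Proof.
move=> e; transitivity ((a + b) * (a * g * r)); first by ring.
by rewrite e; ring.
Qed.

Section Symmetrizers.
Variables (k : fieldType) (q : k) (n : nat).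
Variable rw : 'S_n -> seq 'I_n.
Hypothesis rwP : forall w, reduced_word w (rw w).
Local Notation F := (RatF k n).
Implicit Types (i j : 'I_n) (w : 'S_n) (g h : F).
Local Notation qF := (cF n q).

Definition hecke_sum g : F := \sum_(w : 'S_n) Tword q (rw w) g.

(** The word chosen for [stp i * w] need not begin with [i]; [matsumoto] makes the choice
    immaterial. *)
Lemma Tword_stp i w g : (i.+1 < n)%N -> (w i < w (ord_succ i))%N ->
  Tword q (rw (stp i * w)) g = Top_T q i (Tword q (rw w) g).
Proof.
move=> hi asc; rewrite -[RHS]/(foldr (@Top_T k q n) g (i :: rw w)) /Tword.
apply: (matsumoto rwP).
- by move=> a b ab hb g'; apply: Top_T_far.
- by move=> a b ab hb g'; apply: Top_T_near.
- exact: rwP.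
- by apply: cons_reduced_word; rewrite ?stpK // !permM /stp tpermL tpermR.
Qed.

(** Each [w] with an ascent at [i] is paired with [stp i * w], which has a descent there. Every
    summand then lies in the image of 1 + T_i, whence the symmetry of the sum. *)
Lemma hecke_sum_asc i g : (i.+1 < n)%N ->
  hecke_sum g = \sum_(w : 'S_n | (w i < w (ord_succ i))%N)
     (Tword q (rw w) g + Top_T q i (Tword q (rw w) g)).
Proof.
move=> hi; rewrite big_split /= /hecke_sum.
rewrite (bigID (fun w : 'S_n => (w i < w (ord_succ i))%N)) /=; congr (_ + _).
rewrite (reindex_inj (mulgI (stp i))) /=; apply: eq_big => [w|w].
  by rewrite !permM /stp tpermL tpermR ltn_perm_succ // negbK.
rewrite !permM /stp tpermL tpermR -ltn_perm_succ // => asc.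
exact: Tword_stp.
Qed.

Lemma msymF_stp_hecke_sum i g : (i.+1 < n)%N -> msymF (stp i) (hecke_sum g) = hecke_sum g.
Proof.
move=> hi; rewrite (hecke_sum_asc g hi) msymF_sum; apply: eq_bigr => w _.
by rewrite Top_T1E // msymFD -msymF_comp /stp tperm2 msymF_id addrC.
Qed.

Lemma msymF_hecke_sum w g : msymF w (hecke_sum g) = hecke_sum g.
Proof.
case/and3P: (rwP w) => hs /eqP <- _; elim: (rw w) hs => [_|i s IH /= /andP[hi hs]].
  by rewrite big_nil msymF_id.
by rewrite big_cons msymF_comp msymF_stp_hecke_sum // IH.
Qed.

Definition qkernel : F := \prod_(p : 'I_n * 'I_n | (p.1 < p.2)%N) qratio q p.1 p.2.

Definition qsym g : F := \sum_(w : 'S_n) msymF w (g * qkernel).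

Lemma qsymD g h : qsym (g + h) = qsym g + qsym h.
Proof. by rewrite -big_split; apply: eq_bigr => w _; rewrite /= mulrDl msymFD. Qed.

Lemma qsym_msymF w g : qsym (msymF w g) = \sum_(v : 'S_n) msymF v (g * msymF w^-1 qkernel).
Proof.
rewrite /qsym [RHS](reindex_inj (mulgI w)); apply: eq_bigr => v _ /=.
rewrite msymF_comp; congr (msymF v _).
by rewrite msymFM -[msymF w (msymF _ qkernel)]msymF_comp mulVg msymF_id.
Qed.

Lemma qratioD i j : i != j -> qratio q i j + qratio q j i = qF + 1.
Proof.
move=> ij; have := xF_neq k ij; rewrite /qratio; move: (xF k i) (xF k j) qF => a b c.
by move=> ab; rewrite -[b - a]opprB invrN mulrN -mulNr -mulrDl; apply/(canLR (mulfK ab)); ring.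
Qed.

(** Apply [qsym] to (1 + T_i) g and move s_i onto the kernel. Only the factor at (i, i+1) changes,
    and the two versions of it add up to q + 1 by [qratioD]. *)
Lemma qsym_Top_T i g : (i.+1 < n)%N -> qsym (Top_T q i g) = qF * qsym g.
Proof.
move=> hi; apply: (addrI (qsym g)); rewrite -qsymD Top_T1E // qsymD qsym_msymF.
pose Q' := \prod_(p : 'I_n * 'I_n | (p.1 < p.2)%N && (p != (i, ord_succ i))) qratio q p.1 p.2.
have hQ : qkernel = qratio q i (ord_succ i) * Q' by rewrite /qkernel (big_ltn_succ _ _ hi).
have hQ' : msymF (stp i) Q' = Q'.
  rewrite msymF_prod; under eq_bigr do rewrite msymF_qratio.
  by rewrite (big_ltn_stp _ (@qratio k q n) hi).
rewrite {1}hQ [(stp i)^-1%g]tpermV msymFM msymF_qratio hQ' tpermL tpermR.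
rewrite /qsym -big_split /= mulr_sumr -big_split /=; apply: eq_bigr => w _.
rewrite -msymFD -(msymF_cF w q) -msymFM -msymFD; congr (msymF w _).
rewrite hQ; exact: add_mul_exchange (qratioD (neq_ord_succ hi)).
Qed.

Lemma qsym_Tword s g : all (fun i : 'I_n => i.+1 < n)%N s ->
  qsym (Tword q s g) = qF ^+ size s * qsym g.
Proof.
elim: s => [_|i s IH /andP[hi hs]]; first by rewrite expr0 mul1r.
by rewrite [size _]/= exprS -mulrA -(IH hs) -(qsym_Top_T _ hi).
Qed.

Lemma qsym_hecke_sum g :
  hecke_sum g * qsym 1 = (\sum_(w : 'S_n) qF ^+ inversions w) * qsym g.
Proof.
(* This term is evaluated twice: the symmetric [hecke_sum g] factors out of [qsym], and each T_w
   contributes q to its length. *)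
transitivity (qsym (hecke_sum g)).
  rewrite /qsym mulr_sumr; apply: eq_bigr => w _.
  by rewrite mul1r msymFM msymF_hecke_sum.
rewrite {1}/hecke_sum mulr_suml.
rewrite (big_morph qsym qsymD (_ : qsym 0 = 0)); last first.
  by rewrite /qsym big1 // => w _; rewrite mul0r msymF0.
by apply: eq_bigr => w _; case/and3P: (rwP w) => hs _ /eqP <-; apply: qsym_Tword.
Qed.

End Symmetrizers.

(** * Pairs of indices and the staircase exponent *)

Section Pairs.
Variable n : nat.
Variable rw : 'S_n -> seq 'I_n.
Hypothesis rwP : forall w, reduced_word w (rw w).
Implicit Types (i j : 'I_n) (w : 'S_n) (A : {set 'I_n}).

(** The reduced words also witness that adjacent transpositions generate the group. *)
Lemma perm_stp_ind (Q : 'S_n -> Prop) : Q 1%g ->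
  (forall i w, (i.+1 < n)%N -> Q w -> Q (stp i * w)%g) -> forall w, Q w.
Proof.
move=> Q1 QS w; case/and3P: (rwP w) => hs /eqP <- _.
elim: (rw w) hs => [_|i s IH /= /andP[hi /IH Qs]]; first by rewrite big_nil.
by rewrite big_cons; apply: QS.
Qed.

Lemma big_ltn_perm (R : Type) (idx : R) (op : Monoid.com_law idx) w
    (G : 'I_n -> 'I_n -> R) : (forall i j, G i j = G j i) ->
  \big[op/idx]_(p : 'I_n * 'I_n | (p.1 < p.2)%N) G (w p.1) (w p.2) =
  \big[op/idx]_(p : 'I_n * 'I_n | (p.1 < p.2)%N) G p.1 p.2.
Proof.
elim/perm_stp_ind: w G => [|i w hi IH] G sG.
  by apply: eq_bigr => p _; rewrite !perm1.
rewrite -(IH G sG) !(big_ltn_succ _ _ hi) /=; congr (op _ _).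
  by rewrite !permM tpermL tpermR sG.
under eq_bigr do rewrite !permM.
exact: (big_ltn_stp _ (fun a b => G (w a) (w b)) hi).
Qed.

Lemma sum_pairs A (G : 'I_n -> 'I_n -> nat) : (forall i, G i i = 0%N) ->
  (\sum_(i in A) \sum_(j in A) G i j =
  \sum_(p : 'I_n * 'I_n | [&& p.1 < p.2, p.1 \in A & p.2 \in A])
    (G p.1 p.2 + G p.2 p.1))%N.
Proof.
move=> G0; rewrite pair_big_dep /= (bigID (fun p : 'I_n * 'I_n => p.1 < p.2)%N) /=.
rewrite big_split /=; congr (_ + _)%N.
  by apply: eq_bigl => p; rewrite andbC.
rewrite (bigID (fun p : 'I_n * 'I_n => p.1 == p.2)) /= big1 ?add0n; last first.
  by move=> p /andP[_ /eqP ->].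
rewrite (reindex_inj (inv_inj (_ : involutive (fun p : 'I_n * 'I_n => (p.2, p.1))))) /=.
  by apply: eq_bigl => p; rewrite -val_eqE /=; case: (p.1 \in A); case: (p.2 \in A); lia.
by case.
Qed.

(** The binomial coefficient of [#|A|] over 2, kept as a sum over pairs to match degrees of products
    over pairs. *)
Definition npairs A := 
  (\sum_(p : 'I_n * 'I_n | [&& p.1 < p.2, p.1 \in A & p.2 \in A]) 1)%N.

Lemma sum_lt_pairs A (m : 'I_n -> nat) : {in A &, injective m} ->
  (\sum_(i in A) \sum_(j in A) (m j < m i) = npairs A)%N.
Proof.
move=> minj; rewrite (sum_pairs A (G := fun i j => (m j < m i)%N : nat)) => [|i]; last by rewrite ltnn.
apply: eq_bigr => -[a b] /= /and3P[ab aA bA].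
have : m a != m b by apply: contraTneq ab => /(minj _ _ aA bA) ->; rewrite ltnn.
by lia.
Qed.

Lemma sum_lt_le A (m : 'I_n -> nat) i : {in A &, injective m} ->
  (\sum_(j in A) (m j < m i) <= m i)%N.
Proof.
move=> minj; pose B := [set j in A | (m j < m i)%N].
have -> : (\sum_(j in A) (m j < m i) = #|B|)%N.
  rewrite -sum1_card [LHS](eq_bigr (fun j => if (m j < m i)%N then 1%N else 0%N)).
    by rewrite -big_mkcondr; apply: eq_bigl => j; rewrite inE.
  by move=> j _; case: ifP.
have uB : uniq [seq m j | j <- enum B].
  rewrite map_inj_in_uniq ?enum_uniq // => a b.
  by rewrite !mem_enum !inE => /andP[aA _] /andP[bA _]; apply: minj.
rewrite cardE -(size_map m) -[X in (_ <= X)%N](size_iota 0); apply: uniq_leq_size => //.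
by move=> _ /mapP[j + ->]; rewrite mem_enum inE mem_iota => /andP[].
Qed.

(** Distinct values add up to at least 0 + 1 + ... + ([#|A|] - 1), since [m i] is at least the
    number of smaller values taken on [A]. *)
Lemma npairs_le A (m : 'I_n -> nat) : {in A &, injective m} ->
  (npairs A <= \sum_(i in A) m i)%N.
Proof.
move=> minj; rewrite -(sum_lt_pairs minj).
by apply: leq_sum => i iA; apply: sum_lt_le.
Qed.

(** A value of [n] or more would exceed the number of smaller values, which is below [n], making the
    termwise bound strict. *)
Lemma npairs_eq A (m : 'I_n -> nat) : {in A &, injective m} ->
  (\sum_(i in A) m i <= npairs A)%N -> {in A, forall i, m i < n}%N.
Proof.
move=> minj; rewrite -(sum_lt_pairs minj) => le i iA.
rewrite ltnNge; apply: contraL le => ni; rewrite -ltnNge.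
rewrite (bigD1 i) //= [X in (_ < X)%N](bigD1 i) //=.
apply: (@leq_ltn_trans (\sum_(j in A) (m j < m i) + \sum_(j in A | j != i) m j)%N).
  by rewrite leq_add2l; apply: leq_sum => j /andP[jA _]; apply: sum_lt_le.
rewrite ltn_add2r; apply: leq_trans ni.
rewrite (bigD1 i) //= ltnn add0n.
apply: (@leq_ltn_trans (\sum_(j in A | j != i) 1)%N).
  by apply: leq_sum => j _; case: (_ < _)%N.
rewrite sum1_card; apply: leq_trans (_ : #|'I_n| <= n)%N; last by rewrite card_ord.
apply: proper_card; apply/properP; split; first by apply/subsetP.
by exists i => //; rewrite unfold_in eqxx andbF.
Qed.

(** The staircase (n-1, ..., 1, 0), as the sum of the leading exponents of the factors x_a - x_b of
    the Vandermonde product. *)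
Definition delta : 'X_{1..n} :=
  \big[+%MM/0%MM]_(p : 'I_n * 'I_n | (p.1 < p.2)%N) U_(p.1)%MM.

Lemma mdeg_delta : mdeg delta = npairs setT.
Proof.
rewrite /delta mdeg_sum /npairs; apply: eq_big => [p|p _]; last by rewrite mdeg1.
by rewrite !inE !andbT.
Qed.

Lemma deltaE i : delta i = (n - i.+1)%N.
Proof.
rewrite /delta mnm_sumE; under eq_bigr do rewrite mnm1E.
rewrite -(pair_big_dep predT (fun a b : 'I_n => a < b)%N (fun a _ => nat_of_bool (a == i))) /=.
rewrite (bigD1 i) //= [X in (_ + X)%N]big1 ?addn0 => [|a /negPf ->]; last by rewrite big1.
rewrite eqxx big_mkcond /= -(big_mkord predT (fun j : nat => if (i < j)%N then 1%N else 0%N)).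
elim: {1 3}n => [|l IH]; first by rewrite big_geq.
by rewrite big_nat_recr //= IH; case: ifP; lia.
Qed.

Lemma perm_delta (m : 'X_{1..n}) : injective m -> (mdeg m <= mdeg delta)%N ->
  exists w : 'S_n, m = [multinom delta (w i) | i < n].
Proof.
move=> minj; rewrite mdeg_delta mdegE => le.
have hlt i : (m i < n)%N.
  apply: (@npairs_eq setT) => //; first by move=> ? ? _ _; apply: minj.
  by apply: leq_trans le; rewrite leq_eqVlt; apply/orP; left; apply/eqP/eq_bigl => ?; rewrite inE.
(* [delta] takes the value [m i] at index n - 1 - [m i]; sending [i] there is the required
   permutation. *)
have hr i : (n - (m i).+1 < n)%N by have := hlt i; lia.
have finj : injective (fun i => Ordinal (hr i)).
  move=> a b /(congr1 val) /= e; apply: minj.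
  by have := hlt a; have := hlt b; lia.
exists (perm finj); apply/mnmP => i; rewrite mnmE deltaE permE /=.
by have := hlt i; lia.
Qed.

End Pairs.

(** * Antisymmetrization *)

Section Antisymmetrization.
Variables (k : fieldType) (n : nat).
Hypothesis pchar0 : [pchar k] =i pred0.
Variable rw : 'S_n -> seq 'I_n.
Hypothesis rwP : forall w, reduced_word w (rw w).
Local Notation P := {mpoly k[n]}.
Local Notation delta := (delta n).
Implicit Types (i j : 'I_n) (w : 'S_n) (p r : P) (m : 'X_{1..n}) (c d : k).

Definition alt p : P := \sum_(w : 'S_n) (-1) ^+ w *: msym w p.

Lemma alt_is_linear : linear alt.
Proof.
move=> c p r; rewrite /alt scaler_sumr -big_split; apply: eq_bigr => w _ /=.
by rewrite msymD msymZ scalerDr !scalerA mulrC.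
Qed.
HB.instance Definition _ := GRing.isLinear.Build k P P _ alt alt_is_linear.

Lemma alt_msym w p : alt (msym w p) = (-1) ^+ w *: alt p.
Proof.
rewrite /alt scaler_sumr [RHS](reindex_inj (mulgI w)); apply: eq_bigr => v _ /=.
by rewrite msymMm scalerA odd_permM signr_addb mulrA -signr_addb addbb mul1r.
Qed.

Lemma alt_tperm p i j : i != j -> msym (tperm i j) p = p -> alt p = 0.
Proof.
move=> ij e; have := alt_msym (tperm i j) p; rewrite e odd_tperm ij expr1 scaleN1r.
move=> /eqP; rewrite -addr_eq0 -mulr2n -scaler_nat scaler_eq0 => /orP[|/eqP //].
by rewrite ((pcharf0P k).1 pchar0).
Qed.

Lemma msym_tpermX m i j : m i = m j -> msym (tperm i j) 'X_[k, m] = 'X_[m].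
Proof.
move=> e; rewrite msymX tpermV; congr 'X_[_]; apply/mnmP => a; rewrite mnmE.
by case: tpermP => // ->.
Qed.

Definition alt_lead p : k := (alt p)@_delta.

Lemma alt_lead_msym w p : alt_lead (msym w p) = (-1) ^+ w * alt_lead p.
Proof. by rewrite /alt_lead alt_msym mcoeffZ. Qed.

Lemma alt_lead_delta : alt_lead 'X_[delta] = 1.
Proof.
rewrite /alt_lead raddf_sum (bigD1 1%g) //= big1 => [|w w1].
  by rewrite odd_perm1 expr0 scale1r msym1m mcoeffX eqxx addr0.
rewrite mcoeffZ msymX mcoeffX; case: eqP => [/mnmP e|_]; last by rewrite mulr0.
case/eqP: w1; apply/permP => i; have := e (w i); rewrite mnmE permK perm1 !deltaE.
by move=> h; apply: val_inj => /=; have := ltn_ord i; have := ltn_ord (w i); lia.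
Qed.

(** A repeated exponent gives zero, and distinct exponents of degree at most that of [delta] form a
    permutation of [delta]. *)
Lemma altX m : (mdeg m <= mdeg delta)%N -> alt 'X_[m] = alt_lead 'X_[m] *: alt 'X_[delta].
Proof.
move=> le; case: (boolP (injectiveb m)) => [/injectiveP minj|/injectivePn[i [j ij e]]]; last first.
  have a0 := alt_tperm ij (msym_tpermX e).
  by rewrite /alt_lead a0 mcoeff0 scale0r.
have [w ->] := perm_delta minj le.
have -> : [multinom delta (w i) | i < n] = [multinom delta ((w^-1)^-1 i)%g | i < n].
  by rewrite invgK.
by rewrite -msymX alt_lead_msym alt_msym alt_lead_delta mulr1.
Qed.

Lemma alt_small p : (msize p <= (mdeg delta).+1)%N -> alt p = alt_lead p *: alt 'X_[delta].
Proof.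
move=> le; rewrite /alt_lead; move: (alt 'X_[delta]) (altX) => X hX.
rewrite [p]mpolyE !raddf_sum /= scaler_suml.
rewrite [LHS]big_seq [RHS]big_seq; apply: eq_bigr => m hm.
rewrite !linearZ /= -scalerA -hX //.
by have := leq_trans (msize_mdeg_lt hm) le.
Qed.

Lemma mlead_linear_form c d i j : (i < j)%N ->
  (mlead (c *: 'X_i + d *: 'X_j : P) <= U_(i)%MM)%O.
Proof.
move=> ij; apply: le_trans (mleadD_le _ _) _; rewrite leUx.
apply/andP; split; apply: le_trans (mleadZ_le _ _) _; rewrite mleadXm //.
apply/ltW/ltmcP; first by rewrite !mdeg1.
exists i; last by rewrite !mnm1E eqxx -val_eqE /=; case: eqP => //; lia.
by move=> a ai; rewrite !mnm1E -!val_eqE /=; do 2! (case: eqP => //); lia.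
Qed.

(** Upper bounds on the leading monomials replace equalities because a coefficient such as q may
    vanish. *)
Lemma mcoeff_prod_mlead_le (I : Type) (s : seq I) (Q : pred I) (G : I -> P)
    (M : I -> 'X_{1..n}) : (forall x, Q x -> mlead (G x) <= M x)%O ->
  (\prod_(x <- s | Q x) G x)@_(\big[+%MM/0%MM]_(x <- s | Q x) M x) =
  \prod_(x <- s | Q x) (G x)@_(M x).
Proof.
move=> le; pose R (p : P) m c := p@_m = c /\ (mlead p <= m)%O.
suff: R (\prod_(x <- s | Q x) G x) (\big[+%MM/0%MM]_(x <- s | Q x) M x)
        (\prod_(x <- s | Q x) (G x)@_(M x)) by case.
apply: (big_rec3 R) => [|x p m c /le h [<- hp]].
  by split; rewrite ?mlead1 ?lexx // mcoeff1 eqxx.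
split; first by rewrite mleadcMW.
by apply: le_trans (mleadM_le _ _) _; apply: lem_add.
Qed.

(* x^delta is the product of the leading monomials of the factors. *)
Lemma mcoeff_delta_prod w (c d : k) :
  (\prod_(p : 'I_n * 'I_n | (p.1 < p.2)%N) (c *: 'X_(w p.1) + d *: 'X_(w p.2) : P))@_delta =
  \prod_(p : 'I_n * 'I_n | (p.1 < p.2)%N) (if (w p.1 < w p.2)%N then c else d).
Proof.
(* The larger of the two monomials is that of the smaller index; [mn] is symmetric, so
   [big_ltn_perm] can remove [w]. *)
pose mn (a b : 'I_n) : 'X_{1..n} := if (a < b)%N then U_(a)%MM else U_(b)%MM.
have -> : delta = \big[+%MM/0%MM]_(p : 'I_n * 'I_n | (p.1 < p.2)%N) mn (w p.1) (w p.2).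
  rewrite (big_ltn_perm rwP _ w (G := mn)); last first.
    by move=> a b; rewrite /mn; case: ltngtP => // /val_inj ->.
  by apply: eq_bigr => p lt; rewrite /mn lt.
have wne (p : 'I_n * 'I_n) : (p.1 < p.2)%N -> (w p.1 < w p.2)%N || (w p.2 < w p.1)%N.
  move=> lt; rewrite -neq_ltn val_eqE (inj_eq perm_inj).
  by apply: contraTneq lt => ->; rewrite ltnn.
rewrite mcoeff_prod_mlead_le => [|p /wne]; last first.
  rewrite /mn; case: ltnP => [lt _|_ /= lt]; first exact: mlead_linear_form.
  by rewrite addrC mlead_linear_form.
apply: eq_bigr => p /wne; rewrite /mn mcoeffD !mcoeffZ.
case: ltnP => [lt _|_ /= lt]; rewrite !mcoeffXU eqxx -val_eqE /=.
  by rewrite [_ == _ :> nat]eq_sym (ltn_eqF lt) mulr1 mulr0 addr0.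
by rewrite [_ == _ :> nat]eq_sym (ltn_eqF lt) mulr1 mulr0 add0r.
Qed.

Definition vdm : P := \prod_(p : 'I_n * 'I_n | (p.1 < p.2)%N) ('X_(p.1) - 'X_(p.2)).

Lemma msym_vdm w : msym w vdm = (-1) ^+ w *: vdm.
Proof.
elim/(perm_stp_ind rwP): w => [|i w hi IH]; first by rewrite odd_perm1 expr0 scale1r msym1m.
have odd_stp : stp i = true :> bool by rewrite odd_tperm neq_ord_succ.
suff e : msym (stp i) vdm = - vdm.
  by rewrite msymMm e msymN IH odd_permM odd_stp signr_addb expr1 mulN1r scaleNr.
rewrite /vdm rmorph_prod !(big_ltn_succ _ _ hi) /= -mulNr; congr (_ * _).
  by rewrite msymB !msymXU /stp tpermL tpermR opprB.
under eq_bigr do rewrite msymB !msymXU.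
exact: (big_ltn_stp _ (fun a b => 'X_a - 'X_b : P) hi).
Qed.

Lemma dhomog_linear_form c d i j : (c *: 'X_i + d *: 'X_j : P) \is 1.-homog.
Proof. by rewrite rpredD // rpredZ // dhomogX /= mdeg1. Qed.

Lemma dhomog_big_prod (I : Type) (s : seq I) (Q : pred I) (G : I -> P) (D : I -> nat) :
  (forall x, Q x -> G x \is (D x).-homog) ->
  \prod_(x <- s | Q x) G x \is (\sum_(x <- s | Q x) D x)%N.-homog.
Proof.
move=> h; elim/big_rec2: _ => [|x d p /h hx hp]; first exact: dhomog1.
exact: dhomogM.
Qed.

Lemma dhomog_msize_le D p : p \is D.-homog -> (msize p <= D.+1)%N.
Proof.
move=> /dhomogP h; rewrite msizeE; apply/bigmax_leqP_seq => m hm _.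
by rewrite h.
Qed.

(** Antisymmetrizing [vdm] multiplies it by n!, and by [alt_small] also yields n! times the
    alternant of [delta]; characteristic zero allows cancellation. *)
Lemma alt_delta : alt 'X_[delta] = vdm.
Proof.
have fact0 : (n`!)%:R != 0 :> k by rewrite ((pcharf0P k).1 pchar0) -lt0n fact_gt0.
have hv : alt vdm = (n`!)%:R *: vdm.
  rewrite /alt; under eq_bigr do rewrite msym_vdm scalerA -signr_addb addbb expr0 scale1r.
  by rewrite sumr_const card_Sn scaler_nat.
have hl : alt_lead vdm = (n`!)%:R.
  rewrite /alt_lead hv mcoeffZ /vdm.
  have := mcoeff_delta_prod 1 1 (-1).
  under eq_bigr do rewrite !perm1 scale1r scaleN1r.
  move=> ->; rewrite big1 ?mulr1 // => p; by rewrite !perm1 => ->.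
have hs : (msize vdm <= (mdeg delta).+1)%N.
  apply: dhomog_msize_le; rewrite /delta mdeg_sum; apply: dhomog_big_prod => p _.
  by rewrite mdeg1 -[X in X - _]scale1r -scaleN1r dhomog_linear_form.
by apply: (scalerI fact0); rewrite -hv (alt_small hs) hl.
Qed.

End Antisymmetrization.

(** * The generating function of inversions *)

Section InversionGeneratingFunction.

Lemma inversions_sum n (w : 'S_n) :
  inversions w = (\sum_(i < n) \sum_(j < n) ((i < j) && (w j < w i)))%N.
Proof.
rewrite inversionsE big_mkcond pair_bigA /=; apply: eq_bigr => p _.
by case: ltnP.
Qed.

(** The first position, holding the value [j], is inverted with exactly the [j] smaller values, all
    of which come later. *)
Lemma inversions_lift_perm n (j : 'I_n.+1) (s : 'S_n) :
  inversions (lift_perm ord0 j s) = (j + inversions s)%N.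
Proof.
rewrite !inversions_sum big_ord_recl; congr (_ + _)%N.
  rewrite big_ord_recl /= add0n lift_perm_id.
  under eq_bigr do rewrite lift_perm_lift /=.
  transitivity (\sum_(b < n) (lift j b < j))%N.
    by rewrite [RHS](reindex_perm s).
  transitivity (\sum_(0 <= b < n) (b < j))%N.
    by rewrite big_mkord; apply: eq_bigr => b _; rewrite /= /bump; case: leqP; lia.
  elim: n j {s} => [|n IH] j; first by rewrite big_geq //; case: j => [[|[]]].
  have [lt|] := ltnP j n.+1; last first.
    move=> le; have -> : nat_of_ord j = n.+1 by have := ltn_ord j; lia.
    rewrite big_nat_cond (eq_bigr (fun _ => 1%N)) => [|b]; last by case/andP; lia.
    by rewrite -big_nat_cond sum_nat_const_nat; lia.
  by rewrite big_nat_recr //= -[nat_of_ord j]/(nat_of_ord (Ordinal lt)) IH /=; lia.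
apply: eq_bigr => a _; rewrite big_ord_recl /= add0n.
by apply: eq_bigr => b _; rewrite !lift_perm_lift /= /bump; lia.
Qed.

(** Splitting a permutation into its first value and the pattern of the rest peels off one
    q-integer. *)
Lemma sum_expr_inversions (R : comNzRingType) (q : R) n :
  \sum_(w : 'S_n) q ^+ inversions w = \prod_(i < n) \sum_(l < i.+1) q ^+ l.
Proof.
elim: n => [|n IH].
  rewrite big_ord0 (bigD1 1%g) //= big1 ?addr0 => [|w]; last first.
    by case/eqP; apply/permP; case.
  by rewrite inversions_sum big_ord0.
rewrite big_ord_recr /= -IH mulrC.
pose h (p : 'I_n.+1 * 'S_n) := lift_perm ord0 p.1 p.2.
have hinj : injective h.
  move=> [j s] [j' s'] /permP e; have := e ord0; rewrite !lift_perm_id /= => ej.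
  rewrite -ej in e *; congr (_, _); apply/permP => i; have := e (lift ord0 i).
  by rewrite !lift_perm_lift => /lift_inj.
have hbij : bijective h.
  by apply: inj_card_bij => //; rewrite card_prod !card_Sn card_ord factS.
rewrite (reindex h) /=; last exact: onW_bij.
rewrite mulr_suml -(pair_bigA _ (fun j s => q ^+ inversions (lift_perm ord0 j s))) /=.
apply: eq_bigr => j _; rewrite mulr_sumr; apply: eq_bigr => s _.
by rewrite inversions_lift_perm exprD.
Qed.

End InversionGeneratingFunction.

(** * The constant term of the q-divided symmetrization *)

Lemma tofrac_cancel (R : idomainType) (a b c d : R) : c != 0 ->
  a%:F / c%:F * ((b * c)%:F / d%:F) = (a * b)%:F / d%:F.
Proof.
move=> c0; have c0' : c%:F != 0 by rewrite tofrac_eq0.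
by rewrite !tofracM [b%:F * _]mulrC -!mulrA mulKf.
Qed.

Section Residue.
Variables (k : fieldType) (q : k) (n : nat).
Hypothesis pchar0 : [pchar k] =i pred0.
Variable rw : 'S_n -> seq 'I_n.
Hypothesis rwP : forall w, reduced_word w (rw w).
Local Notation P := {mpoly k[n]}.
Local Notation F := (RatF k n).
Local Notation delta := (delta n).
Implicit Types (i j : 'I_n) (w : 'S_n) (p r h : P) (m : 'X_{1..n}) (A : {set 'I_n}).

Definition qform (x : 'I_n * 'I_n) : P := q *: 'X_(x.1) - 'X_(x.2).
Definition simple_forms : P := \prod_(i : 'I_n | (i.+1 < n)%N) qform (i, ord_succ i).
(** The numerators of [qkernel] that survive cancellation with the denominator of the q-divided
    symmetrization. *)
Definition far_forms : P := \prod_(x : 'I_n * 'I_n | (x.1.+1 < x.2)%N) qform x.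
Definition all_forms : P := \prod_(x : 'I_n * 'I_n | (x.1 < x.2)%N) qform x.

Lemma all_formsE : all_forms = far_forms * simple_forms.
Proof.
rewrite /all_forms (bigID (fun x : 'I_n * 'I_n => x.1.+1 < x.2)%N) /=; congr (_ * _).
  by apply: eq_bigl => x; lia.
rewrite /simple_forms.
have e i : qform (i, ord_succ i) = \prod_(j | j == ord_succ i) qform (i, j).
  by rewrite big_pred1_eq.
under [RHS]eq_bigr do rewrite e.
rewrite pair_big_dep /=; apply: eq_big => [[a b]|[a b]] //=.
have [lt|ge] := ltnP a.+1 n; first by rewrite -val_eqE /= val_ord_succ //; lia.
by have := ltn_ord b; lia.
Qed.

Lemma qform_homog x : qform x \is 1.-homog.
Proof. by rewrite /qform -scaleN1r dhomog_linear_form. Qed.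

Lemma qform_neq0 x : x.1 != x.2 -> qform x != 0.
Proof.
move=> ne; apply/eqP => /(congr1 (mcoeff U_(x.2))); apply/eqP.
by rewrite mcoeffB mcoeffZ !mcoeffXU (negPf ne) eqxx mulr0 sub0r mcoeff0 oppr_eq0 oner_eq0.
Qed.

Lemma simple_forms_neq0 : simple_forms != 0.
Proof.
by apply/prodf_neq0 => i hi; apply: qform_neq0; apply: neq_ord_succ.
Qed.

Lemma vdm_neq0 : vdm k n != 0.
Proof.
apply/prodf_neq0 => x lt; apply/eqP => /(congr1 (mcoeff U_(x.1))); apply/eqP.
rewrite mcoeffB !mcoeffXU eqxx mcoeff0 -val_eqE /= gtn_eqF //.
by rewrite subr0 oner_eq0.
Qed.

Lemma qkernelE : qkernel q n = all_forms%:F / (vdm k n)%:F.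
Proof.
rewrite /qkernel prodf_div; congr (_ / _); rewrite rmorph_prod; apply: eq_bigr => x _.
  by rewrite /= /qform tofracB -mul_mpolyC tofracM.
by rewrite /= tofracB.
Qed.

Lemma qsym_frac p :
  qsym q (p%:F / simple_forms%:F) = (alt (p * far_forms))%:F / (vdm k n)%:F.
Proof.
have -> : qsym q (p%:F / simple_forms%:F) =
          \sum_(w : 'S_n) msymF w ((p * far_forms)%:F / (vdm k n)%:F).
  apply: eq_bigr => w _; congr (msymF w _); rewrite qkernelE all_formsE.
  exact: tofrac_cancel simple_forms_neq0.
rewrite /alt raddf_sum mulr_suml; apply: eq_bigr => w _.
rewrite msymF_div ?vdm_neq0 // (msym_vdm k rwP) /=.
case: (odd_perm w); rewrite ?expr0 ?expr1 ?scale1r // !scaleN1r !tofracN.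
by rewrite invrN mulrN mulNr.
Qed.

(** Taken for [p] of any degree, so that it is linear on the whole ring and one can speak of ideals
    in its kernel. *)
Definition residue p : k := alt_lead (p * far_forms).

Lemma residue_is_scalar : scalar residue.
Proof.
move=> c p r; rewrite /residue /alt_lead mulrDl -scalerAl.
by rewrite linearP mcoeffD mcoeffZ.
Qed.
HB.instance Definition _ := GRing.isLinear.Build k P k *%R residue residue_is_scalar.

Lemma cFE (c : k) (v : P) : v != 0 -> (c *: v)%:F / v%:F = cF n c.
Proof. by move=> v0; rewrite -mul_mpolyC tofracM mulfK ?tofrac_eq0. Qed.

Lemma qsym_residue p : (msize (p * far_forms) <= (mdeg delta).+1)%N ->
  qsym q (p%:F / simple_forms%:F) = cF n (residue p).
Proof.
move=> le; rewrite qsym_frac (alt_small pchar0 le) (alt_delta pchar0 rwP).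
exact: cFE vdm_neq0.
Qed.

Lemma all_forms_homog : all_forms \is (mdeg delta).-homog.
Proof.
rewrite /delta mdeg_sum; apply: dhomog_big_prod => x _.
by rewrite mdeg1 qform_homog.
Qed.

Lemma qsym1 : qsym q 1 = cF n (residue simple_forms).
Proof.
rewrite -qsym_residue ?divff ?tofrac_eq0 ?simple_forms_neq0 //.
by rewrite mulrC -all_formsE; apply: dhomog_msize_le all_forms_homog.
Qed.

(** Both sides are the coefficient of x^delta in the image of [vdm] under [w]. *)
Lemma prod_signs w :
  \prod_(x : 'I_n * 'I_n | (x.1 < x.2)%N) (if (w x.1 < w x.2)%N then 1 else -1) =
  (-1) ^+ w :> k.
Proof.
have vE (v : 'S_n) : \prod_(x : 'I_n * 'I_n | (x.1 < x.2)%N)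
    (1 *: 'X_(v x.1) + (-1) *: 'X_(v x.2)) = msym v (vdm k n).
  by rewrite rmorph_prod; apply: eq_bigr => x _; rewrite /= msymB !msymXU scale1r scaleN1r.
rewrite -(mcoeff_delta_prod rwP) vE (msym_vdm k rwP) mcoeffZ -[vdm _ _]msym1m -vE.
rewrite (mcoeff_delta_prod rwP) big1 ?mulr1 // => x; by rewrite !perm1 => ->.
Qed.

Lemma residue_simple_forms : residue simple_forms = \sum_(w : 'S_n) q ^+ inversions w.
Proof.
rewrite /residue mulrC -all_formsE /alt_lead /alt raddf_sum /=.
(* The coefficient has a factor q per non-inversion of the permutation; composing with the reversal
   turns these into the inversions of [w]. The signs cancel by [prod_signs]. *)
rewrite (reindex_inj (mulIg (perm (@rev_ord_inj n)))); apply: eq_bigr => w _ /=.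
set v := (w * _)%g.
rewrite mcoeffZ rmorph_prod /=.
have -> : \prod_(x : 'I_n * 'I_n | (x.1 < x.2)%N) msym v (qform x) =
    \prod_(x : 'I_n * 'I_n | (x.1 < x.2)%N) (q *: 'X_(v x.1) + (-1) *: 'X_(v x.2)).
  by apply: eq_bigr => x _; rewrite /qform msymB msymZ !msymXU scaleN1r.
rewrite (mcoeff_delta_prod rwP) -prod_signs -big_split /= inversionsE.
rewrite (big_morph _ (exprD q) (expr0 q)); apply: eq_bigr => x lt.
have -> : (v x.1 < v x.2)%N = (w x.2 < w x.1)%N.
  by rewrite !permM !permE /=; have := ltn_ord (w x.1); have := ltn_ord (w x.2); lia.
by case: (_ < _)%N; rewrite ?mul1r ?expr1 // mulrNN mulr1.
Qed.

End Residue.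

(** * The kernel of the residue *)

Section ResidueKernel.
Variables (k : fieldType) (q : k) (n : nat).
Hypothesis pchar0 : [pchar k] =i pred0.
Local Notation P := {mpoly k[n]}.
Local Notation delta := (delta n).
Implicit Types (i j : 'I_n) (w : 'S_n) (p r h : P) (m : 'X_{1..n}) (A : {set 'I_n}).

Lemma alt_lead_is_scalar : scalar (@alt_lead k n).
Proof. by move=> c p r; rewrite /alt_lead linearP mcoeffD mcoeffZ. Qed.
HB.instance Definition _ :=
  GRing.isLinear.Build k P k *%R (@alt_lead k n) alt_lead_is_scalar.

Lemma alt_lead_homog D p : p \is D.-homog -> D != mdeg delta -> alt_lead p = 0.
Proof.
move=> hp ne; rewrite /alt_lead /alt raddf_sum big1 // => w _.
rewrite /= mcoeffZ mcoeff_sym (dhomog_nemf_coeff hp) ?mulr0 //.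
by rewrite /= mdeg_mperm eq_sym.
Qed.

(* A monomial factor x^m with m a = m b for a, b in the same block is killed by
   the transposition (a b); otherwise the exponents of m are distinct on both
   blocks, which makes the degree too large. *)
Lemma alt_lead_blocks A D p r :
  r \is D.-homog ->
  (forall a b, (a \in A) = (b \in A) -> msym (tperm a b) r = r) ->
  (mdeg delta < npairs A + npairs (~: A) + D)%N -> alt_lead (p * r) = 0.
Proof.
move=> hr sr hD; rewrite [p]mpolyE mulr_suml linear_sum big1_seq //= => m _.
rewrite -scalerAl linearZ /=.
case: (boolP [exists a, exists b, [&& a != b, m a == m b & (a \in A) == (b \in A)]]).
  case/existsP => a /existsP[b /and3P[ab /eqP mab /eqP eA]].
  rewrite /alt_lead (alt_tperm pchar0 ab) ?mcoeff0 ?mulr0 //.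
  by rewrite msymM msym_tpermX // sr.
move=> /existsPn hm.
have minj a b : (a \in A) = (b \in A) -> m a = m b -> a = b.
  move=> eA e; have /existsPn/(_ b) := hm a.
  by rewrite e eA !eqxx !andbT negbK => /eqP.
have le : (npairs A + npairs (~: A) <= mdeg m)%N.
  have -> : mdeg m = (\sum_(i in A) m i + \sum_(i in ~: A) m i)%N.
    by rewrite mdegE (bigID (mem A)) /=; congr (_ + _)%N; apply: eq_bigl => a; rewrite inE.
  apply: leq_add; apply: npairs_le => a b.
    by move=> aA bA; apply: minj; rewrite aA bA.
  by rewrite !inE => /negPf aA /negPf bA; apply: minj; rewrite aA bA.
rewrite (@alt_lead_homog (mdeg m + D)) ?mulr0 //; last by lia.
by apply: dhomogM => //; rewrite dhomogX.
Qed.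

Definition ypart (j : nat) : P := \sum_(a : 'I_n | (a < j)%N) 'X_a.

Lemma ypart_homog (j : nat) : ypart j \is 1.-homog.
Proof. by apply: rpred_sum => a _; rewrite dhomogX /= mdeg1. Qed.

Definition cross (j : nat) : P :=
  \prod_(x : 'I_n * 'I_n | (x.1 < j)%N && (j <= x.2)%N) qform q x.

(** Both factors are symmetric within the first [j] indices and within the rest. Pairs inside and
    across the blocks account for the degree of [delta], and [ypart j] exceeds it by one. *)
Lemma alt_lead_ypart_cross (j : nat) p : alt_lead (p * (ypart j * cross j)) = 0.
Proof.
pose A := [set a : 'I_n | (a < j)%N].
pose C := (\sum_(x : 'I_n * 'I_n | (x.1 < j)%N && (j <= x.2)%N) 1)%N.
have tA a b (x : 'I_n) : (a \in A) = (b \in A) -> (tperm a b x < j)%N = (x < j)%N.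
  by rewrite !inE => e; case: tpermP => [->|->|].
apply: (@alt_lead_blocks A (1 + C)).
- by apply: dhomogM (ypart_homog j) _; apply: dhomog_big_prod => x _; apply: qform_homog.
- move=> a b e; rewrite msymM; congr (_ * _).
    rewrite /ypart raddf_sum [RHS](reindex_inj (@perm_inj _ (tperm a b))) /=.
    by apply: eq_big => [x|x _]; rewrite ?msymXU ?tA.
  rewrite /cross rmorph_prod.
  have hK : involutive (fun x : 'I_n * 'I_n => (tperm a b x.1, tperm a b x.2)).
    by move=> x; rewrite /= !tpermK; case: x.
  rewrite [RHS](reindex_inj (inv_inj hK)) /=; apply: eq_big => [x|x _].
    by rewrite ltnNge -ltnNge -[(j <= x.2)%N]negbK -ltnNge -(tA a b x.1 e) -(tA a b x.2 e) -leqNgt.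
  by rewrite /qform msymB msymZ !msymXU.
- have -> : mdeg delta = (npairs A + npairs (~: A) + C)%N; last by rewrite add1n addnS ltnSn.
  rewrite mdeg_delta /npairs (bigID (fun x : 'I_n * 'I_n => x.1 < j)%N) /=.
  rewrite (bigID (fun x : 'I_n * 'I_n => x.2 < j)%N) /= -addnA [X in (_ + X)%N]addnC addnA.
  by congr (_ + _ + _)%N; apply: eq_bigl => x; rewrite !inE /=; lia.
Qed.

Lemma residue_ypart_full h : residue q (h * ypart n) = 0.
Proof.
rewrite /residue mulrAC.
have := alt_lead_ypart_cross n (h * far_forms q n); rewrite /cross big_pred0 ?mulr1 // => x.
by rewrite [(n <= _)%N]leqNgt !ltn_ord.
Qed.

Lemma residue_krel i h : (i.+1 < n)%N ->
  residue q (h * (ypart i.+1 * qform q (i, ord_succ i))) = 0.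
Proof.
move=> hi; have hs := val_ord_succ hi; rewrite /residue.
(* (i, i+1) is the only adjacent pair straddling the cut, so adding its form to [far_forms]
   completes [cross i.+1]. *)
have [rest e] : exists rest, far_forms q n * qform q (i, ord_succ i) = rest * cross i.+1.
  pose Q (x : 'I_n * 'I_n) := (x.1.+1 < x.2)%N || (x == (i, ord_succ i)).
  exists (\prod_(x : 'I_n * 'I_n | Q x && ~~ ((x.1 < i.+1)%N && (i.+1 <= x.2)%N)) qform q x).
  transitivity (\prod_(x | Q x) qform q x).
    rewrite [RHS](bigD1 (i, ord_succ i)) /=; last by rewrite /Q eqxx orbT.
    rewrite mulrC; congr (_ * _); apply: eq_bigl => x; rewrite /Q.
    by case: eqP => [->|_]; rewrite ?andbT ?orbF //= hs; lia.
  rewrite (bigID (fun x : 'I_n * 'I_n => (x.1 < i.+1)%N && (i.+1 <= x.2)%N)) /= mulrC.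
  congr (_ * _); apply: eq_bigl => -[a b]; rewrite /Q xpair_eqE -!val_eqE /= hs; lia.
rewrite -mulrA -mulrA [qform _ _ * _]mulrC e.
have -> : h * (ypart i.+1 * (rest * cross i.+1)) = (h * rest) * (ypart i.+1 * cross i.+1).
  by rewrite -!mulrA [rest * (_ * _)]mulrCA.
exact: alt_lead_ypart_cross.
Qed.

End ResidueKernel.

(** * The Klyachko relations *)

Section KlyachkoRelations.
Variables (R : comNzRingType) (J : R -> Prop) (c : R) (y : nat -> R) (n : nat).
Hypothesis JB : forall a b, J a -> J b -> J (a - b).
Hypothesis JM : forall a b, J b -> J (a * b).

Definition qnum (m : nat) : R := \sum_(l < m) c ^+ l.
(** Equals c (y_j - y_{j-1}) - (y_{j+1} - y_j), the form l_j in terms of partial sums. Its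
    coefficients are those of the recurrence [qnum2]. *)
Definition klin (j : nat) : R := (c + 1) * y j - c * y j.-1 - y j.+1.

Hypothesis y0 : y 0 = 0.
Hypothesis Jyn : J (y n).
Hypothesis Jkrel : forall j, (0 < j < n)%N -> J (y j * klin j).

Lemma qnum2 m : qnum m.+2 = (c + 1) * qnum m.+1 - c * qnum m.
Proof. by rewrite /qnum !big_ord_recr /= exprS; ring. Qed.

Let J0 : J 0. Proof. by rewrite -(mul0r (y n)); apply: JM. Qed.
Let JD a b : J a -> J b -> J (a + b).
Proof. by move=> ha hb; rewrite -[b]opprK -[- b]sub0r; apply: JB => //; apply: JB. Qed.

Let Y m := \prod_(m <= a < n) y a.

(** A rule for rewriting the square of y_m, by downward induction on [m] with [d] = n - [m]. It
    starts from y_n in [J], and each step uses one relation. *)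
Lemma klyachko_square_top d m : (m + d = n)%N -> (0 < m)%N ->
  J (qnum d.+1 * y m * Y m - c * qnum d * y m.-1 * Y m).
Proof.
elim: d m => [|d IH] m.
  rewrite addn0 => -> _; rewrite /Y big_geq // /qnum big_ord_recr !big_ord0 /=.
  by have -> : (0 + c ^+ 0) * y n * 1 - c * 0 * y n.-1 * 1 = 1 * y n; [ring | apply: JM].
move=> e m0; have := IH m.+1; rewrite addSnnS /= => /(_ e isT) IHm.
have -> : Y m = y m * Y m.+1 by rewrite /Y big_ltn //; lia.
have -> : qnum d.+2 * y m * (y m * Y m.+1) - c * qnum d.+1 * y m.-1 * (y m * Y m.+1) =
  qnum d.+1 * Y m.+1 * (y m * klin m) +
  y m * (qnum d.+1 * y m.+1 * Y m.+1 - c * qnum d * y m * Y m.+1).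
  by rewrite qnum2 /klin; ring.
by apply: JD; apply: JM => //; apply: Jkrel; lia.
Qed.

(** Modulo [J] the product keeps two terms; the one with y_{m-1} disappears at [m] = 1. In the step,
    y_m l_m is discarded and [klyachko_square_top] removes the square of y_{m+1}. *)
Lemma klyachko_prod_suffix d m : (m + d = n)%N -> (0 < m)%N ->
  J (\prod_(m <= a < n) klin a -
     (qnum d.+1 * Y m - c * qnum d * y m.-1 * Y m.+1)).
Proof.
elim: d m => [|d IH] m.
  rewrite addn0 => -> _; rewrite /Y !big_geq // /qnum big_ord_recr !big_ord0 /=.
  by have -> : 1 - ((0 + c ^+ 0) * 1 - c * 0 * y n.-1 * 1) = 0; [ring | exact: J0].
move=> e m0; have := IH m.+1; rewrite addSnnS /= => /(_ e isT) IHm.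
have := @klyachko_square_top d m.+1; rewrite addSnnS /= => /(_ e isT) sq.
have -> : Y m = y m * Y m.+1 by rewrite /Y big_ltn //; lia.
rewrite big_ltn; last by lia.
set Pi := \prod_(m.+1 <= a < n) _ in IHm *.
have -> : klin m * Pi - (qnum d.+2 * (y m * Y m.+1) - c * qnum d.+1 * y m.-1 * Y m.+1) =
  klin m * (Pi - (qnum d.+1 * Y m.+1 - c * qnum d * y m * Y m.+2)) -
  (c * qnum d * Y m.+2) * (y m * klin m) -
  (qnum d.+1 * y m.+1 * Y m.+1 - c * qnum d * y m * Y m.+1).
  by rewrite qnum2 /klin; ring.
by apply: JB => //; apply: JB; apply: JM => //; apply: Jkrel; lia.
Qed.

Lemma klyachko_prod : (0 < n)%N ->
  J (\prod_(1 <= a < n) klin a - qnum n * \prod_(1 <= a < n) y a).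
Proof.
move=> n0; have := @klyachko_prod_suffix n.-1 1; rewrite add1n prednK //= => /(_ erefl isT).
by rewrite y0 mulr0 mul0r subr0.
Qed.

End KlyachkoRelations.

(** * Evaluation on the Klyachko algebra *)

Section Evaluation.
Variables (k : fieldType) (q : k) (n : nat).
Hypothesis pchar0 : [pchar k] =i pred0.
Hypothesis qroot : forall m : nat, (0 < m)%N -> q ^+ m = 1 -> q = 1.
Hypothesis n_gt1 : (1 < n)%N.
Variable rw : 'S_n -> seq 'I_n.
Hypothesis rwP : forall w, reduced_word w (rw w).
Local Notation P := {mpoly k[n]}.
Local Notation F := (RatF k n).
Local Notation delta := (delta n).
Local Notation y := (ypart k n).
Implicit Types (i j : 'I_n) (w : 'S_n) (p r h f : P).

(** The largest ideal inside the kernel of [residue]. *)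
Definition residue_null p := forall h, residue q (h * p) = 0.
Local Notation J := residue_null.

Lemma residue_nullB p r : J p -> J r -> J (p - r).
Proof. by move=> hp hr h; rewrite mulrBr linearB /= hp hr subrr. Qed.

Lemma residue_nullM p r : J r -> J (p * r).
Proof. by move=> hr h; rewrite mulrA. Qed.

Lemma residue_null0 : J 0.
Proof. by move=> h; rewrite mulr0 linear0. Qed.

Lemma residue_nullD p r : J p -> J r -> J (p + r).
Proof. by move=> hp hr h; rewrite mulrDr linearD /= hp hr addr0. Qed.

Lemma residue_null_eq p r : J (p - r) -> residue q p = residue q r.
Proof. by move/(_ 1); rewrite mul1r linearB => /subr0_eq. Qed.

Lemma ypartS i : y i.+1 = y i + 'X_i.
Proof.
rewrite /ypart (bigD1 i) //= addrC; congr (_ + _).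
by apply: eq_bigl => a; rewrite ltnS ltn_neqAle -val_eqE andbC.
Qed.

Lemma ypart0 : y 0 = 0.
Proof. by rewrite /ypart big_pred0. Qed.

Lemma qform_klin i : (i.+1 < n)%N -> qform q (i, ord_succ i) = klin q%:MP y i.+1.
Proof.
move=> hi; have := ypartS (ord_succ i); rewrite val_ord_succ // => hs.
rewrite /klin hs /= (ypartS i) /qform -mul_mpolyC /=.
by ring.
Qed.

Lemma residue_null_full : J (y n).
Proof. by move=> h; apply: residue_ypart_full. Qed.

Lemma residue_null_krel (j : nat) : (0 < j < n)%N -> J (y j * klin q%:MP y j).
Proof.
case: j => // j /= hj h; pose i := Ordinal (ltnW hj).
by have := residue_krel q pchar0 h (hj : (i.+1 < n)%N); rewrite qform_klin.
Qed.

Lemma simple_forms_klin : simple_forms q n = \prod_(1 <= a < n) klin q%:MP y a.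
Proof.
rewrite big_add1 (big_nat_widen _ _ n) ?leq_pred //= big_mkord /simple_forms.
by apply: eq_big => [i|i]; [lia | apply: qform_klin].
Qed.

(** A zero would give q^m = 1, hence q = 1, and then the q-integer is [m] itself, non-zero in
    characteristic zero. *)
Lemma qnum_neq0 m : (0 < m)%N -> qnum q m != 0.
Proof.
move=> m0; apply/eqP => e.
have := subrX1 q m; rewrite -/(qnum q m) e mulr0 => /eqP; rewrite subr_eq0 => /eqP.
move=> /(qroot m0) q1; move/eqP: e; rewrite /qnum q1.
under eq_bigr do rewrite expr1n.
by rewrite sumr_const card_ord ((pcharf0P k).1 pchar0); lia.
Qed.

Lemma qfactS m : qfact q m.+1 = qfact q m * qnum q m.+1.
Proof. by rewrite /qfact big_ord_recr. Qed.

Lemma qfact_neq0 m : qfact q m != 0.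
Proof. by apply/prodf_neq0 => i _; apply: (@qnum_neq0 i.+1). Qed.

Lemma residue_simple_qfact : residue q (simple_forms q n) = qfact q n.
Proof. by rewrite (residue_simple_forms q rwP) sum_expr_inversions. Qed.

Lemma residue_yprod : residue q (\prod_(1 <= a < n) y a) = qfact q n.-1.
Proof.
have n0 : (0 < n)%N by lia.
have := klyachko_prod residue_nullB residue_nullM ypart0 residue_null_full residue_null_krel n0.
move/residue_null_eq; rewrite -simple_forms_klin residue_simple_qfact.
have -> : qnum q%:MP n = (qnum q n)%:MP :> P.
  by rewrite /qnum rmorph_sum; apply: eq_bigr => l _; rewrite /= rmorphXn.
rewrite mul_mpolyC linearZ /= -(prednK n0) qfactS mulrC prednK //.
by move/(mulfI (qnum_neq0 n0)).
Qed.

(** In [qsym_hecke_sum] both [qsym 1] and the length generating function equal the non-zero [n]_q!,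
    which cancels. *)
Lemma hecke_sum_residue p :
  (msize (p * far_forms q n) <= (mdeg delta).+1)%N ->
  hecke_sum q rw (p%:F / (simple_forms q n)%:F) = cF n (residue q p).
Proof.
move=> le; rewrite -(qsym_residue pchar0 rwP le).
have := qsym_hecke_sum q rwP (p%:F / (simple_forms q n)%:F).
rewrite (qsym1 q pchar0 rwP) residue_simple_qfact.
have -> : \sum_(w : 'S_n) cF n q ^+ inversions w = cF n (qfact q n).
  rewrite -residue_simple_qfact (residue_simple_forms q rwP) /cF rmorph_sum /= rmorph_sum.
  by apply: eq_bigr => w _; rewrite /= !rmorphXn.
have c0 : cF n (qfact q n) != 0 by rewrite /cF tofrac_eq0 mpolyC_eq0 qfact_neq0.
by rewrite mulrC => /(mulfI c0).
Qed.

Definition nfar := (\sum_(x : 'I_n * 'I_n | (x.1.+1 < x.2)%N) 1)%N.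

Lemma far_forms_homog : far_forms q n \is nfar.-homog.
Proof. by apply: dhomog_big_prod => x _; apply: qform_homog. Qed.

(** The degree of the non-zero [all_forms], read off from its two factorizations. *)
Lemma mdeg_delta_nfar : mdeg delta = (nfar + n.-1)%N.
Proof.
apply: (@dhomog_uniq _ _ mdeg (all_forms q n)).
- by rewrite all_formsE mulf_neq0 ?simple_forms_neq0 //; apply/prodf_neq0 => x lt;
    apply: qform_neq0; rewrite -val_eqE /=; lia.
- exact: all_forms_homog.
rewrite all_formsE; apply: dhomogM far_forms_homog _.
have -> : n.-1 = (\sum_(i < n | i.+1 < n) 1)%N.
  rewrite -(big_mkord (fun a => a.+1 < n)%N (fun=> 1%N)).
  have -> : (\sum_(0 <= a < n | a.+1 < n) 1 = \sum_(0 <= a < n.-1) 1)%N.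
    by rewrite [RHS](big_nat_widen _ _ n) ?leq_pred //; apply: eq_bigl => a; lia.
  by rewrite sum_nat_const_nat; lia.
by apply: dhomog_big_prod => x _; apply: qform_homog.
Qed.

(** Inverts [rho] modulo [residue_null], so that no quotient ring has to be formed. *)
Definition unrho (p : KPol k n) : P := p \mPo [tuple y j.+1 | j < n.-1].

Lemma unrho_uu (i : nat) : (i < n)%N -> unrho (uu k n i) = y i.
Proof.
rewrite /unrho /uu raddf_sum; case: i => [|i] hi.
  by rewrite big_pred0 // ypart0.
have hi' : (i < n.-1)%N by lia.
rewrite (big_pred1 (Ordinal hi')) => [|j]; last by rewrite /= eqSS.
by rewrite /= comp_mpolyXU -tnth_nth tnth_mktuple.
Qed.

Lemma uu_n : uu k n n = 0.
Proof. by rewrite /uu big_pred0 // => j; have := ltn_ord j; lia. Qed.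

(** The difference is zero except at the last variable, where it is y_n. *)
Lemma unrho_rho_x j : J ('X_j - unrho (rho_x k j)).
Proof.
rewrite /rho_x; case: eqP => [j0|/eqP j0].
  rewrite unrho_uu // -j0 ypartS j0 ypart0 add0r subrr; exact: residue_null0.
case: eqP => [jn|/eqP jn].
  have -> : unrho (- uu k n n.-1) = - y n.-1 by rewrite /unrho raddfN /= -/(unrho _) unrho_uu //; lia.
  have -> : n.-1 = j by lia.
  rewrite opprK addrC -ypartS (congr1 y jn); exact: residue_null_full.
have hj := ltn_ord j.
have -> : unrho (uu k n j.+1 - uu k n j) = 'X_j.
  by rewrite /unrho raddfB /= -!/(unrho _) !unrho_uu ?ypartS 1?addrC ?addKr //; lia.
rewrite subrr; exact: residue_null0.
Qed.

(** The composite is an algebra morphism and [residue_null] an ideal, so it suffices to compare on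
    the variables. *)
Lemma unrho_rho f : J (f - unrho (rho f)).
Proof.
pose E g := J (g - unrho (rho g)).
have EM g h : E g -> E h -> E (g * h).
  rewrite /E; have -> : unrho (rho (g * h)) = unrho (rho g) * unrho (rho h).
    by rewrite /unrho /rho !rmorphM.
  move: (unrho (rho g)) (unrho (rho h)) => a b eg eh.
  have -> : g * h - a * b = g * (h - b) + b * (g - a).
    by rewrite !mulrBr [b * g]mulrC [b * a]mulrC addrA subrK.
  exact: residue_nullD (residue_nullM _ eh) (residue_nullM _ eg).
have E1 : E 1 by rewrite /E /unrho /rho !rmorph1 subrr; exact: residue_null0.
have EX i : E 'X_i.
  rewrite /E; have -> : rho 'X_i = rho_x k i by rewrite /rho comp_mpolyXU -tnth_nth tnth_mktuple.
  exact: unrho_rho_x.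
have E0 : E 0 by rewrite /E /unrho /rho !comp_mpoly0 subrr; exact: residue_null0.
have EL c g h : E g -> E h -> E (c *: g + h).
  rewrite /E; have -> : unrho (rho (c *: g + h)) = c *: unrho (rho g) + unrho (rho h).
    by rewrite /unrho /rho !linearP.
  move: (unrho (rho g)) (unrho (rho h)) => a b eg eh.
  rewrite opprD addrACA -scalerBr -mul_mpolyC.
  exact: residue_nullD (residue_nullM _ eg) eh.
suff: E f by []; clearbody E.
elim/mpolyind: f => [|c m p _ _]; first exact: E0.
apply: EL; rewrite mpolyXE_id; elim/big_ind: _ => [|g h|i _]; [exact: E1 | exact: EM |].
by elim: (m i) => [|e IH]; [rewrite expr0 | rewrite exprS; apply: EM].
Qed.

Lemma unrho_krel (i : nat) : (0 < i < n)%N -> J (unrho (@krel k q n i)).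
Proof.
(* The correction term matters at i = n - 1, where u_n is zero but y_n is only in the ideal. *)
move=> hi; have -> : unrho (@krel k q n i) =
    y i * klin q%:MP y i + y i * (y i.+1 - unrho (uu k n i.+1)).
  have e : unrho (@krel k q n i) = (q + 1) *: (y i * y i)
      - q *: (y i * y i.-1) - y i * unrho (uu k n i.+1).
    rewrite /krel expr2 /unrho !comp_mpolyB !comp_mpolyZ !rmorphM /= -!/(unrho _).
    have lt1 : (i < n)%N by lia.
    have lt2 : (i.-1 < n)%N by lia.
    by rewrite (unrho_uu lt1) (unrho_uu lt2).
  rewrite e /klin -!mul_mpolyC mpolyCD mpolyC1.
  by move: (unrho _) (y i) (y i.-1) (y i.+1) q%:MP => a b c d e'; ring.
apply: residue_nullD; first exact: residue_null_krel.
apply: residue_nullM; have [lt|ge] := ltnP i.+1 n.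
  rewrite unrho_uu // subrr; exact: residue_null0.
have -> : i.+1 = n by lia.
rewrite uu_n /unrho raddf0 subr0; exact: residue_null_full.
Qed.

Lemma residue_uI (I : {set 'I_n.-1}) :
  residue q (unrho (uI k I)) = (I == setT)%:R * qfact q n.-1.
Proof.
have -> : unrho (uI k I) = \prod_(j in I) y j.+1.
  rewrite /unrho /uI rmorph_prod; apply: eq_bigr => j _.
  by rewrite /= comp_mpolyXU -tnth_nth tnth_mktuple.
case: eqP => [->|neT]; last first.
  (* A proper subset gives degree below n - 1, so the total degree misses that of [delta]. *)
  rewrite mul0r; apply: (@alt_lead_homog k n (\sum_(j in I) 1 + nfar)).
    by apply: dhomogM far_forms_homog; apply: dhomog_big_prod => j _; apply: ypart_homog.
  rewrite mdeg_delta_nfar addnC eqn_add2l sum1_card; apply/eqP => e; apply: neT.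
  by apply/eqP; rewrite eqEcard subsetT cardsT card_ord e leqnn.
rewrite mul1r -residue_yprod big_add1 big_mkord; congr residue.
by apply: eq_bigl => j; rewrite inE.
Qed.

End Evaluation.

(** * From the residue to the top coefficient *)

Unset Implicit Arguments. Set Strict Implicit. Set Printing Implicit Defensive.

Theorem theorem1p1 (k : fieldType) (hchar : [pchar k] =i pred0)
  (q : k) (hq : forall m : nat, (0 < m)%N -> q ^+ m = 1 -> q = 1)
  (n : nat) (hn : (2 <= n)%N)
  (f : {mpoly k[n]}) (hdeg : msize f = n)
  (rw : 'S_n -> seq 'I_n) (hrw : forall w : 'S_n, reduced_word w (rw w))
  (a : {set 'I_n.-1} -> k)
  (ha : in_Kideal q (rho f - \sum_(I : {set 'I_n.-1}) a I *: @uI k n I)) :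
  qdivsym q rw f = @cF k n (qfact q n.-1 * a setT).
Proof.
have -> : qdivsym q rw f = hecke_sum q rw (f%:F / (simple_forms q n)%:F).
  by rewrite /qdivsym /hecke_sum /simple_forms rmorph_prod.
rewrite (hecke_sum_residue hchar hq hn hrw); last first.
  (* [msizeM] wants non-zero factors. As [msize] is the degree plus one, the bound to reach is n - 1
     + [nfar], the degree of [delta]. *)
  have f0 : f != 0 by rewrite -msize_poly_eq0 hdeg; case: n hn {hdeg f ha a rw hrw}.
  have [->|far0] := eqVneq (far_forms q n) 0; first by rewrite mulr0 msize0.
  rewrite msizeM // hdeg (mdeg_delta_nfar q hn).
  move: (msize (far_forms q n)) (dhomog_msize_le (far_forms_homog q n)) => s le.
  by clear -hn le; lia.
(* Replacing [f] by [unrho (rho f)] brings in the expansion [ha]: the relations have residue zero,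
   and only the full set contributes. *)
congr cF; rewrite (residue_null_eq (unrho_rho q hchar hn f)).
case: ha => c /eqP; rewrite subr_eq => /eqP ->.
have -> : unrho (\sum_(1 <= i < n) c i * @krel k q n i + \sum_I a I *: @uI k n I) =
  \sum_(1 <= i < n) unrho (c i) * unrho (@krel k q n i) +
  \sum_I a I *: unrho (@uI k n I).
  rewrite /unrho comp_mpolyD; congr (_ + _).
    by rewrite rmorph_sum; apply: eq_bigr => i _; rewrite rmorphM.
  by rewrite raddf_sum; apply: eq_bigr => I _; rewrite /= comp_mpolyZ.
rewrite linearD /= !linear_sum /= [X in X + _]big_nat_cond big1 ?add0r => [|i /andP[hi _]]; last first.
  exact: unrho_krel.
rewrite (bigD1 setT) //= big1 ?addr0 => [|I /negPf IT].
  by rewrite linearZ /= (residue_uI hchar hq hn hrw) eqxx mul1r mulrC.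
by rewrite linearZ /= (residue_uI hchar hq hn hrw) IT mul0r mulr0.
Qed.
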